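(* Let $Z$ be a separable infinite-dimensional (real or complex) Banach space containing a complemented copy of a space with a sub-symmetric basis. Then there exists a bounded linear operator on $Z$ which is universal for ergodic systems.
   Context: A Schauder basis $(e_n)_{n\ge 0}$ of an infinite-dimensional Banach space is sub-symmetric if it is unconditional and equivalent to each of its subsequences. $Z$ contains a complemented copy of a space $E$ if $Z$ can be written as a topological direct sum $Z=E'\oplus Y$ of closed subspaces with $E'$ isomorphic to $E$. A dynamical system $(X,\mathcal{B},\mu;T)$ consists of a probability space $(X,\mathcal{B},\mu)$ and a $\mu$-preserving measurable transformation $T$ of $X$ (not necessarily invertible). A standard Lebesgue probability space is a probability space isomorphic (mod null sets) to $[0,1]$ with Lebesgue measure. Isomorphism of dynamical systems means measure-theoretic isomorphism (mod null sets). $\mathcal{B}_Z$ denotes the Borel $\sigma$-field of $Z$; a Borel probability measure $\nu$ on $Z$ has full support if $\nu(U)>0$ for every non-empty open $U\subseteq Z$. A bounded operator $A$ on $Z$ is universal for ergodic systems if for every ergodic dynamical system $(X,\mathcal{B},\mu;T)$ on a standard Lebesgue probability space there exists an $A$-invariant Borel probability measure $\nu$ on $Z$ with full support such that the dynamical systems $(X,\mathcal{B},\mu;T)$ and $(Z,\mathcal{B}_Z,\nu;A)$ are isomorphic. *)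

(* Defs.v *)
From HB Require Import structures.
From mathcomp Require Import all_boot all_order all_algebra.
From mathcomp Require Import all_classical all_reals all_analysis.
From mathcomp Require Import complex.

Set Implicit Arguments.
Unset Strict Implicit.
Unset Printing Implicit Defensive.

Import Order.TTheory GRing.Theory Num.Theory.
Import numFieldNormedType.Exports.

Local Open Scope classical_set_scope.
Local Open Scope ring_scope.

Section banach.
Context {K : numFieldType}.
Implicit Types E F Z : completeNormedModType K.

Definition separable Z := exists2 D : set Z, countable D & dense D.

Definition infinite_dimensional Z :=
  forall (n : nat) (v : 'I_n -> Z), exists x : Z,
  forall c : 'I_n -> K, x <> \sum_(i < n) c i *: v i.

Definition bounded_operator E F (f : {linear E -> F}) :=
  exists M : K, forall x, `|f x| <= M * `|x|.

Definition basis_series E (e : nat -> E) (a : nat -> K) : nat -> E :=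
  series (fun n => a n *: e n).

Definition schauder_basis E (e : nat -> E) :=
  forall x : E, exists! a : nat -> K, basis_series e a @ \oo --> x.

Definition unconditionally_convergent E (u : nat -> E) :=
  forall s : nat -> nat, bijective s -> cvgn (series (u \o s)).

Definition unconditional_basis E (e : nat -> E) :=
  schauder_basis e /\
  forall (x : E) (a : nat -> K), basis_series e a @ \oo --> x ->
    unconditionally_convergent (fun n => a n *: e n).

(* Equivalence of basic sequences, each a basis of its own closed span. *)
Definition equivalent_sequences E F (e : nat -> E) (f : nat -> F) :=
  forall a : nat -> K, cvgn (basis_series e a) <-> cvgn (basis_series f a).

Definition subsymmetric_basis E (e : nat -> E) :=
  unconditional_basis e /\
  forall s : nat -> nat, {homo s : m n / (m < n)%N} ->
    equivalent_sequences e (e \o s).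

Definition closed_subspace Z (S : set Z) :=
  [/\ closed S, S 0 & forall (a : K) x y, S x -> S y -> S (a *: x + y)].

(* The last clause is the continuity of the projection onto S along Y. *)
Definition topological_direct_sum Z (S Y : set Z) :=
  [/\ closed_subspace S, closed_subspace Y, S `&` Y = [set 0],
      forall z, exists x y, [/\ S x, Y y & z = x + y]
    & exists C : K, forall x y, S x -> Y y -> `|x| <= C * `|x + y|].

Definition isomorphic_to_subspace E Z (S : set Z) :=
  exists J : {linear E -> Z},
    [/\ bounded_operator J, range J = S
      & exists C : K, forall x, `|x| <= C * `|J x|].

Definition complemented_copy E Z :=
  exists S Y : set Z, topological_direct_sum S Y /\ isomorphic_to_subspace E S.

Definition complemented_subsymmetric Z :=
  exists E : completeNormedModType K,
    [/\ infinite_dimensional E,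
        exists e : nat -> E, subsymmetric_basis e
      & complemented_copy E Z].

End banach.

Notation borel_space Z := (g_sigma_algebraType (@open Z)).

Section dynamics.
Context {R : realType}.

(* A belongs to the completion of the sigma-algebra and its completed measure
   is r. *)
Definition completed_measure d (X : measurableType d)
    (mu : {measure set X -> \bar R}) (A : set X) (r : \bar R) :=
  exists B, [/\ measurable B, mu.-negligible (A `+` B) & mu B = r].

(* phi is a measure-preserving bijection between conull sets, measurable in
   both directions.  Measurability is with respect to the completed
   sigma-algebras, so that for instance the Borel and the Lebesgue
   sigma-algebras on [0,1] give isomorphic spaces. *)
Definition isomorphism_mod0 d1 d2 (X : measurableType d1)
    (Y : measurableType d2) (mu : {measure set X -> \bar R})
    (nu : {measure set Y -> \bar R}) (X0 : set X) (Y0 : set Y)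
    (phi : X -> Y) :=
  [/\ measurable X0 /\ mu (~` X0) = 0%E,
      measurable Y0 /\ nu (~` Y0) = 0%E,
      set_bij X0 Y0 phi,
      forall B, measurable B ->
        completed_measure mu (X0 `&` phi @^-1` B) (nu B)
    & forall A, measurable A ->
        completed_measure nu (phi @` (X0 `&` A)) (mu A)].

Definition isomorphic_spaces d1 d2 (X : measurableType d1)
    (Y : measurableType d2) (mu : {measure set X -> \bar R})
    (nu : {measure set Y -> \bar R}) :=
  exists X0 Y0 phi, isomorphism_mod0 mu nu X0 Y0 phi.

Definition isomorphic_systems d1 d2 (X : measurableType d1)
    (Y : measurableType d2) (mu : {measure set X -> \bar R}) (T : X -> X)
    (nu : {measure set Y -> \bar R}) (S : Y -> Y) :=
  exists X0 Y0 phi,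
    [/\ isomorphism_mod0 mu nu X0 Y0 phi,
        set_fun X0 X0 T, set_fun Y0 Y0 S
      & forall x, X0 x -> phi (T x) = S (phi x)].

(* Lebesgue measure on [0,1], as a measure on R vanishing outside [0,1]. *)
Definition lebesgue01 :
    {measure set (measurableTypeR R) -> \bar R} :=
  mrestr lebesgue_measure (measurable_itv `[(0 : R), 1]).

Definition standard_lebesgue d (X : measurableType d) (mu : probability X R) :=
  isomorphic_spaces mu lebesgue01.

Definition measure_preserving d (X : measurableType d) (mu : probability X R)
    (T : X -> X) :=
  measurable_fun setT T /\
  forall A, measurable A -> mu (T @^-1` A) = mu A.

Definition ergodic d (X : measurableType d) (mu : probability X R)
    (T : X -> X) :=
  measure_preserving mu T /\
  forall A, measurable A -> T @^-1` A = A -> mu A = 0%E \/ mu A = 1%E.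

Definition full_support {K : numFieldType} (Z : completeNormedModType K)
    (nu : probability (borel_space Z) R) :=
  forall U : set Z, open U -> U !=set0 -> (0 < nu U)%E.

Definition universal_for_ergodic {K : numFieldType}
    (Z : completeNormedModType K) (A : {linear Z -> Z}) :=
  forall (d : measure_display) (X : measurableType d) (mu : probability X R)
    (T : X -> X),
    standard_lebesgue mu -> ergodic mu T ->
    exists nu : probability (borel_space Z) R,
      [/\ measure_preserving nu (A : borel_space Z -> borel_space Z),
          full_support nu
        & isomorphic_systems mu T nu (A : borel_space Z -> borel_space Z)].

End dynamics.

Arguments universal_for_ergodic R {K Z} A.

(* Main.v *)
(* Write Z = E + Y with E carrying a sub-symmetric basis (e_m).  The operator A kills Y, maps
   e_{2m+1} to a large multiple of e_m and e_{2k} to a small multiple of the k-th term of a dense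
   sequence of Y.  Unconditionality and sub-symmetry make A bounded, and backward A-orbits
   c_0 <- c_1 <- c_2 <- ... with A c_0 = 0 and |c_n| = O(4^-n), called chains, have elements
   spanning a dense subspace of Z.  Given an ergodic T, attach to x a chain c(x) and put
   phi(x) = \sum_n c(T^n x)_n, so that phi (T x) = A (phi x).  The chains are chosen among countably
   many letters, each perturbed by a multiple of a real coordinate of x that can be read off from
   phi(x), which makes phi injective with a Borel inverse.  The letters are distributed by means of
   towers with very small bases, so that every word of a list approximating a dense sequence of Z
   is read, followed by a negligible tail, with positive probability: this is full support. *)

Require Import Defs.
From HB Require Import structures.
From mathcomp Require Import all_boot all_order all_algebra.
From mathcomp Require Import all_classical all_reals all_analysis.
From mathcomp Require Import measurable_realfun complex ring lra zify.

Set Implicit Arguments.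
Unset Strict Implicit.
Unset Printing Implicit Defensive.

Import Order.TTheory GRing.Theory Num.Theory.
Import numFieldNormedType.Exports.

Local Open Scope classical_set_scope.
Local Open Scope ring_scope.

(** * Real-valued norms over real or complex scalars *)

(** Full support forces letters of unbounded norm, while phi(x) must converge. The two demands are
    reconciled by the bound [2 ^+ N j * 4^-1 ^+ m] on the m-th element of a letter of word j: it is
    at most [2^-1 ^+ m] once m reaches N j. The towers have only to ensure that almost every orbit
    meets a letter of a word j before time N j for finitely many times. As T need not be invertible,
    the base of a tower marks the last letter of its word, so that letters depend on the forward
    orbit only. The shift e_{2m+1} -> e_m, instead of e_{m+1} -> e_m, leaves infinitely many even
    indices free: each of them starts a chain, the indices 0 and 2 feed two functionals l0 and l1
    vanishing on all later chain elements, and the others reach Y. Word j approximates the dense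
    vector whose index is the 2-adic valuation of j, so each vector is served by arbitrarily late
    words, whose perturbations and tails are small. Ergodicity is used through a Borel model S of T
    on the real line that agrees with T only almost everywhere, hence in a form that tolerates null
    sets. *)

(* Norms in a normedModType K take their values in K; this structure turns them into elements of R,
   uniformly for K = R and K = R[i]. *)
Record real_scalars (R : realType) (K : numFieldType) := RealScalars {
  emb : {rmorphism R -> K};
  re : {additive K -> R};
  re_emb : forall r, re (emb r) = r;
  emb_re : forall x, 0 <= x -> emb (re x) = x;
  emb_ge0 : forall r, 0 <= r -> 0 <= emb r;
  re_ge0 : forall x, 0 <= x -> 0 <= re x;
  re_le_norm : forall x, `|re x| <= re `|x|;
  scalars_complete : forall u : nat -> K,
    (forall eps : R, 0 < eps -> exists N, forall m n, (N <= m)%N -> (N <= n)%N ->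
       re `|u m - u n| < eps) ->
    exists l, forall eps : R, 0 < eps -> exists N, forall n, (N <= n)%N ->
       re `|u n - l| < eps
}.

Lemma sum_natB (V : zmodType) (f : nat -> V) m n : (m <= n)%N ->
  \sum_(0 <= k < n) f k - \sum_(0 <= k < m) f k = \sum_(m <= k < n) f k.
Proof. by move=> mn; rewrite (big_cat_nat (leq0n m) mn)/= addrAC subrr add0r. Qed.

Section realnorm.
Context {R : realType} {K : numFieldType} (s : real_scalars R K).

Definition rnorm {V : normedZmodType K} (x : V) : R := re s `|x|.

Section zmod.
Context {V : normedZmodType K}.
Implicit Types x y : V.

Lemma emb_rnorm x : emb s (rnorm x) = `|x|.
Proof. exact: emb_re. Qed.

Lemma emb_inj : injective (emb s).
Proof. by move=> a b /(congr1 (re s)); rewrite !re_emb. Qed.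

Lemma ler_emb a b : (emb s a <= emb s b) = (a <= b).
Proof.
apply/idP/idP => h.
  by rewrite -subr_ge0 -(re_emb s (b - a)) re_ge0// rmorphB subr_ge0.
by rewrite -subr_ge0 -rmorphB emb_ge0// subr_ge0.
Qed.

Lemma ltr_emb a b : (emb s a < emb s b) = (a < b).
Proof. by rewrite !lt_neqAle ler_emb (inj_eq emb_inj). Qed.

Lemma rnorm_ge0 x : 0 <= rnorm x.
Proof. exact: re_ge0. Qed.

Lemma rnorm0 : rnorm (0 : V) = 0.
Proof. by rewrite /rnorm normr0 raddf0. Qed.

Lemma rnorm_eq0 x : (rnorm x == 0) = (x == 0).
Proof. by rewrite -(inj_eq emb_inj) emb_rnorm rmorph0 normr_eq0. Qed.

Lemma ler_rnormD x y : rnorm (x + y) <= rnorm x + rnorm y.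
Proof. by rewrite -ler_emb rmorphD !emb_rnorm ler_normD. Qed.

Lemma rnormN x : rnorm (- x) = rnorm x.
Proof. by rewrite /rnorm normrN. Qed.

Lemma rdistC x y : rnorm (x - y) = rnorm (y - x).
Proof. by rewrite /rnorm distrC. Qed.

Lemma ler_rnormB x y : rnorm (x - y) <= rnorm x + rnorm y.
Proof. by rewrite -(rnormN y) ler_rnormD. Qed.

Lemma ler_rdistD z x y : rnorm (x - y) <= rnorm (x - z) + rnorm (z - y).
Proof. by rewrite -ler_emb rmorphD !emb_rnorm ler_distD. Qed.

Lemma ler_rnorm_sum I (r : seq I) (P : pred I) (F : I -> V) :
  rnorm (\sum_(i <- r | P i) F i) <= \sum_(i <- r | P i) rnorm (F i).
Proof.
elim/big_rec2: _ => [|i y x _ h]; first by rewrite rnorm0.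
by apply: (le_trans (ler_rnormD _ _)); rewrite lerD2l.
Qed.

(** Convergence with tolerances in [R] instead of [K], so that estimates stay in an ordered real
    field; [cvg_tends] translates. *)
Definition tends (u : nat -> V) (l : V) := forall eps : R, 0 < eps ->
  exists N, forall n, (N <= n)%N -> rnorm (u n - l) < eps.

Lemma tends_cst l : tends (fun=> l) l.
Proof. by move=> e e0; exists 0%N => n _; rewrite subrr rnorm0. Qed.

Lemma tends_ext u v l : u =1 v -> tends u l -> tends v l.
Proof. by move=> /funext ->. Qed.

Lemma tendsD u v a b : tends u a -> tends v b -> tends (fun n => u n + v n) (a + b).
Proof.
move=> ua vb e e0; have e2 : 0 < e / 2 by rewrite divr_gt0.
have [N hN] := ua _ e2; have [M hM] := vb _ e2.
exists (maxn N M) => n; rewrite geq_max => /andP[/hN h1 /hM h2].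
rewrite opprD addrACA; apply: (le_lt_trans (ler_rnormD _ _)).
by rewrite [e]splitr ltrD.
Qed.

Lemma tendsN u a : tends u a -> tends (fun n => - u n) (- a).
Proof.
move=> ua e e0; have [N hN] := ua _ e0; exists N => n /hN.
by rewrite -opprD rnormN.
Qed.

Lemma tendsB u v a b : tends u a -> tends v b -> tends (fun n => u n - v n) (a - b).
Proof. by move=> ua /tendsN; exact: tendsD. Qed.

Lemma tends_le_eventually u l c N0 : tends u l ->
  (forall n, (N0 <= n)%N -> rnorm (u n) <= c) -> rnorm l <= c.
Proof.
move=> ul uc; apply/ler_addgt0Pr => e e0; have [N hN] := ul _ e0.
have := hN (maxn N N0) (leq_maxl _ _); have := uc (maxn N N0) (leq_maxr _ _).
move=> h1 h2; rewrite -(subrK (u (maxn N N0)) l).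
apply: (le_trans (ler_rnormD _ _)); rewrite addrC lerD// rdistC ltW//.
Qed.

Lemma tends_le u l c : tends u l -> (forall n, rnorm (u n) <= c) -> rnorm l <= c.
Proof. by move=> ul h; apply: (@tends_le_eventually u l c 0) => // n _; exact: h. Qed.

Lemma tends_uniq u a b : tends u a -> tends u b -> a = b.
Proof.
move=> ua ub; apply/eqP; rewrite -subr_eq0 -rnorm_eq0 eq_le rnorm_ge0 andbT.
by apply: (tends_le (tendsB ua ub)) => n; rewrite subrr rnorm0.
Qed.

Lemma tends_bounded u l : tends u l -> exists c, forall n, rnorm (u n) <= c.
Proof.
move=> /(_ 1 ltr01)[N hN].
exists (rnorm l + 1 + \sum_(i < N) rnorm (u i)) => n.
have [nN|Nn] := ltnP n N.
  rewrite (bigD1 (Ordinal nN))//=.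
  have : 0 <= \sum_(i < N | i != Ordinal nN) rnorm (u i).
    by apply: sumr_ge0 => i _; exact: rnorm_ge0.
  have := rnorm_ge0 l; lra.
have := hN _ Nn; have : 0 <= \sum_(i < N) rnorm (u i).
  by apply: sumr_ge0 => i _; exact: rnorm_ge0.
have := ler_rnormD (u n - l) l; rewrite subrK; lra.
Qed.

Definition rcauchy (u : nat -> V) := forall eps : R, 0 < eps ->
  exists N, forall m n, (N <= m)%N -> (m <= n)%N -> rnorm (u n - u m) < eps.

Lemma tends_cauchy u l : tends u l -> rcauchy u.
Proof.
move=> ul e e0; have e2 : 0 < e / 2 by rewrite divr_gt0.
have [N hN] := ul _ e2; exists N => m n Nm mn.
apply: (le_lt_trans (ler_rdistD l _ _)); rewrite [e]splitr ltrD//.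
  by apply: hN; exact: leq_trans mn.
by rewrite rdistC hN.
Qed.

Lemma rcauchy_sum (f : nat -> V) (b : nat -> R) c :
  (forall n, rnorm (f n) <= b n) -> (forall n, \sum_(0 <= k < n) b k <= c) ->
  rcauchy (fun n => \sum_(0 <= k < n) f k).
Proof.
move=> fb bc e e0; pose A := range (fun n => \sum_(0 <= k < n) b k).
have hs : has_sup A.
  split; first by exists (\sum_(0 <= k < 0) b k), 0%N.
  by exists c => _ [n _ <-].
have [_ [N _ <-] hN] := sup_adherent e0 hs.
have b0 n : 0 <= b n by exact: le_trans (rnorm_ge0 _) (fb n).
exists N => m n Nm mn.
rewrite (sum_natB f mn).
apply: (@le_lt_trans _ _ (\sum_(m <= k < n) b k)).
  by apply: (le_trans (ler_rnorm_sum _ _ _)); apply: ler_sum.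
have : \sum_(0 <= k < n) b k <= sup A.
  by apply: ub_le_sup; [case: hs | exists n].
have := sum_natB b mn; have := sum_natB b Nm.
have : 0 <= \sum_(N <= k < m) b k by apply: sumr_ge0.
move: hN; lra.
Qed.

End zmod.

Lemma rnormZ {V : normedModType K} (a : K) (x : V) :
  rnorm (a *: x) = rnorm a * rnorm x.
Proof.
by apply: emb_inj; rewrite rmorphM !emb_rnorm normrZ.
Qed.

Lemma rnormM (a b : K) : rnorm (a * b) = rnorm a * rnorm b.
Proof. by apply: emb_inj; rewrite rmorphM !emb_rnorm normrM. Qed.

Lemma rnorm1 : rnorm (1 : K) = 1.
Proof. by apply: emb_inj; rewrite emb_rnorm rmorph1 normr1. Qed.

Lemma rnormV (a : K) : rnorm a^-1 = (rnorm a)^-1.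
Proof. by apply: emb_inj; rewrite fmorphV !emb_rnorm normfV. Qed.

Lemma rnorm_emb (r : R) : rnorm (emb s r) = `|r|.
Proof.
have [r0|r0] := leP 0 r.
  by rewrite /rnorm ger0_norm ?emb_ge0// re_emb ger0_norm.
rewrite -rnormN -raddfN ltr0_norm// /rnorm ger0_norm ?re_emb//.
by apply: emb_ge0; rewrite oppr_ge0 ltW.
Qed.

Section normed.
Context {V : normedModType K}.
Implicit Types x y : V.

Lemma tendsZ (a : K) u (l : V) : tends u l -> tends (fun n => a *: u n) (a *: l).
Proof.
move=> ul e e0; have h : 0 < e / (rnorm a + 1).
  by rewrite divr_gt0// ltr_wpDl// rnorm_ge0.
have [N hN] := ul _ h; exists N => n /hN.
rewrite -scalerBr rnormZ ltr_pdivlMr ?ltr_wpDl ?rnorm_ge0// => h1.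
apply: le_lt_trans h1; rewrite mulrC ler_wpM2l ?rnorm_ge0// lerDl//.
Qed.

Lemma tendsZl (a : nat -> K) (b : K) (x : V) :
  tends a b -> tends (fun n => a n *: x) (b *: x).
Proof.
move=> ab e e0; have h : 0 < e / (rnorm x + 1).
  by rewrite divr_gt0// ltr_wpDl// rnorm_ge0.
have [N hN] := ab _ h; exists N => n /hN.
rewrite -scalerBl rnormZ ltr_pdivlMr ?ltr_wpDl ?rnorm_ge0// => h1.
apply: le_lt_trans h1; rewrite ler_wpM2l ?rnorm_ge0// lerDl//.
Qed.

Lemma cvg_tends (u : nat -> V) l : (u @ \oo --> l) <-> tends u l.
Proof.
split=> [/cvgrPdist_lt ul e e0|ul].
  have /ul : 0 < emb s e by rewrite -(rmorph0 (emb s)) ltr_emb.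
  move=> [N _ hN]; exists N => n Nn; rewrite rdistC -ltr_emb emb_rnorm.
  exact: hN.
apply/cvgrPdist_lt => e e0; have := emb_re s (ltW e0) => ee.
have /ul[N hN] : 0 < re s e by rewrite -ltr_emb ee rmorph0.
by exists N => // n /= /hN; rewrite rdistC -ltr_emb emb_rnorm ee.
Qed.

Lemma cvgn_tends (u : nat -> V) : cvgn u <-> exists l, tends u l.
Proof.
split; first by move=> h; exists (limn u); apply/cvg_tends.
by move=> [l /cvg_tends h]; apply/cvg_ex; exists l.
Qed.

Lemma nbhs_rball (x : V) (U : set V) :
  nbhs x U <-> exists2 r : R, 0 < r & forall y, rnorm (y - x) < r -> U y.
Proof.
split.
  move=> /nbhs_ballP[e /= e0 he]; have := emb_re s (ltW e0) => ee.
  exists (re s e); first by rewrite -ltr_emb ee rmorph0.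
  move=> y; rewrite -ltr_emb emb_rnorm ee => h; apply: he.
  by rewrite -ball_normE /= distrC.
move=> [r r0 h]; apply/nbhs_ballP; exists (emb s r) => /=.
  by rewrite -(rmorph0 (emb s)) ltr_emb.
by move=> y; rewrite -ball_normE /= distrC -emb_rnorm ltr_emb; exact: h.
Qed.

Lemma open_rball (U : set V) : open U <->
  forall x, U x -> exists2 r : R, 0 < r & forall y, rnorm (y - x) < r -> U y.
Proof.
rewrite openE; split=> h x /h; first by move=> /nbhs_rball.
by move=> ?; apply/nbhs_rball.
Qed.

Lemma rball_open (x : V) (r : R) : open [set y | rnorm (y - x) < r].
Proof.
apply/open_rball => y /= yr; exists (r - rnorm (y - x)); first by rewrite subr_gt0.
move=> z h; apply: (le_lt_trans (ler_rdistD y _ _)); move: h; lra.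
Qed.

End normed.

Lemma rcauchy_tends {V : completeNormedModType K} (u : nat -> V) :
  rcauchy u -> exists l, tends u l.
Proof.
move=> uC; suff h : cvgn u by exists (limn u); apply/cvg_tends.
apply/cauchy_cvgP/cauchy_exP => e e0; have := emb_re s (ltW e0) => ee.
have h : 0 < re s e by rewrite -ltr_emb ee rmorph0.
have [N hN] := uC _ h.
exists (u N); exists N => // n /= Nn.
by rewrite -ball_normE /= distrC -emb_rnorm -ee ltr_emb hN.
Qed.

Lemma tends_sum_abs {V : completeNormedModType K} (f : nat -> V) (b : nat -> R) c :
  (forall n, rnorm (f n) <= b n) -> (forall n, \sum_(0 <= k < n) b k <= c) ->
  exists2 l, tends (fun n => \sum_(0 <= k < n) f k) l & rnorm l <= c.
Proof.
move=> fb bc; have [l fl] := rcauchy_tends (rcauchy_sum fb bc).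
exists l => //; apply: (tends_le fl) => n.
by apply: le_trans (bc n); apply: (le_trans (ler_rnorm_sum _ _ _)); apply: ler_sum.
Qed.

End realnorm.

(** * Countably subadditive seminorms *)

Lemma half_pow_gt0 (R : realType) n : 0 < (2^-1 : R) ^+ n.
Proof. by rewrite exprn_gt0. Qed.

Lemma sum_half_pow_le (R : realType) m n :
  \sum_(m <= k < n) (2^-1 : R) ^+ k <= 2 * 2^-1 ^+ m.
Proof.
have [mn|/ltnW nm] := leqP m n; last by rewrite big_geq// mulr_ge0// exprn_ge0.
suff -> : \sum_(m <= k < n) (2^-1 : R) ^+ k = 2 * 2^-1 ^+ m - 2 * 2^-1 ^+ n.
  have := half_pow_gt0 R n; lra.
elim: n mn => [|n IH]; first by rewrite leqn0 => /eqP ->; rewrite big_geq// subrr.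
rewrite leq_eqVlt => /orP[/eqP ->|]; first by rewrite big_geq// subrr.
rewrite ltnS => mn; rewrite big_nat_recr//= IH// exprS; lra.
Qed.

Lemma half_pow_lt (R : realType) (e : R) : 0 < e ->
  exists N, forall n, (N <= n)%N -> (2^-1 : R) ^+ n < e.
Proof.
have h : `|2^-1 : R| < 1 by rewrite ger0_norm; lra.
move=> e0; have /cvgrPdist_lt/(_ e e0)[N _ hN] := @cvg_geometric R 1 2^-1 h.
exists N => n Nn; have := hN n Nn.
by rewrite sub0r normrN /= mul1r ger0_norm// exprn_ge0.
Qed.

Section zabreiko.
Context {R : realType} {K : numFieldType} (s : real_scalars R K).
Context {E : completeNormedModType K}.
Local Notation rn := (rnorm s).

(* The nested balls of Baire's theorem, whose library version does not cover complex scalars. *)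
Lemma sublevel_somewhere_dense (q : E -> R) :
  exists (n : nat) (x0 : E) (r : R), 0 < r /\
    forall y, rn (y - x0) < r -> forall eps : R, 0 < eps ->
      exists2 a, q a <= n%:R & rn (y - a) < eps.
Proof.
apply: contrapT => hno.
(* If no sublevel set is dense in a ball, every ball of radius r contains a closed ball, of at most
   half the radius, on which [q] exceeds n. The pair [(0, 0)] fills the case r <= 0. *)
have step (t : E * R * nat) : exists u : E * R, 0 < t.1.2 ->
    [/\ 0 < u.2, u.2 <= t.1.2 / 2, rn (u.1 - t.1.1) < t.1.2 / 2 &
     forall z, rn (u.1 - z) <= u.2 -> t.2%:R < q z].
  case: t => [[x0 r] n] /=; have [r0|] := ltP 0 r; last by exists (0, 0).
  have r2 : 0 < r / 2 by rewrite divr_gt0.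
  suff [y [yr [e [e0 he]]]] : exists y, rn (y - x0) < r / 2 /\ exists eps : R, 0 < eps /\
      forall a, rn (y - a) < eps -> n%:R < q a.
    exists (y, Num.min (e / 2) (r / 2)) => _; split => //=.
    - by rewrite lt_min !divr_gt0.
    - by rewrite ge_min lexx orbT.
    - by move=> z hz; apply: he; apply: (le_lt_trans hz); rewrite gt_min; apply/orP; left; lra.
  apply: contrapT => h; apply: hno; exists n, x0, (r / 2); split => // y yr e e0.
  apply: contrapT => h2; apply: h; exists y; split => //; exists e; split => // a ya.
  by rewrite ltNge; apply/negP => qa; apply: h2; exists a.
have [f hf] := choice step.
pose v := fix v n := if n is m.+1 then f (v m, m) else (0, 1) : E * R.
have v0 n : 0 < (v n).2.
  by elim: n => [|n IH] //=; have [] := hf (v n, n) IH.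
have vS n : [/\ (v n.+1).2 <= (v n).2 / 2, rn ((v n.+1).1 - (v n).1) < (v n).2 / 2 &
     forall z, rn ((v n.+1).1 - z) <= (v n.+1).2 -> n%:R < q z].
  by have [] := hf (v n, n) (v0 n).
have vd m n : (m <= n)%N -> rn ((v n).1 - (v m).1) <= (v m).2 - (v n).2.
  elim: n => [|n IH]; first by rewrite leqn0 => /eqP ->; rewrite !subrr rnorm0.
  rewrite leq_eqVlt => /orP[/eqP ->|]; first by rewrite !subrr rnorm0.
  rewrite ltnS => /IH h; have [h1 h2 _] := vS n.
  have := ler_rdistD s (v n).1 (v n.+1).1 (v m).1; lra.
have vr n : (v n).2 <= 2^-1 ^+ n.
  elim: n => [|n IH]; first by rewrite expr0.
  have [h1 _ _] := vS n; rewrite exprS; lra.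
have vc : rcauchy s (fun n => (v n).1).
  move=> e e0; have [N hN] := half_pow_lt e0.
  exists N => m n Nm mn; have := vd _ _ mn; have := v0 n; have := vr m.
  have := hN _ Nm; lra.
have [z hz] := rcauchy_tends vc.
have zq n : n%:R < q z.
  have [_ _] := vS n; apply.
  rewrite rdistC; apply: (tends_le_eventually (N0 := n.+1) (tendsB hz (tends_cst s (v n.+1).1))).
  by move=> m /vd; have := v0 m; lra.
have := archi_boundP (ltW (le_lt_trans (ler0n _ 0) (zq 0%N))).
by apply/negP; rewrite -leNgt ltW.
Qed.

(* Zabreiko's lemma; it replaces both the open mapping and the closed graph theorem below. *)
Lemma countably_subadditive_bounded (q : E -> R) :
  (forall x, 0 <= q x) ->
  (forall x y, q (x + y) <= q x + q y) ->
  (forall a x, q (a *: x) = rn a * q x) ->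
  (forall (u : nat -> E) x c, tends s (fun n => \sum_(0 <= k < n) u k) x ->
     (forall n, \sum_(0 <= k < n) q (u k) <= c) -> q x <= c) ->
  exists2 M, 0 <= M & forall x, q x <= M * rn x.
Proof.
move=> q0 qD qZ qS.
have qN x : q (- x) = q x by rewrite -scaleN1r qZ rnormN rnorm1 mul1r.
have [n [x0 [r [r0 hr]]]] := sublevel_somewhere_dense q.
(* Half the difference of approximants of x0 + y and x0 - y recentres the ball at 0 with the same
   bound n. *)
have h1 y : rn y < r -> forall eps : R, 0 < eps -> exists2 a, q a <= n%:R & rn (y - a) < eps.
  move=> yr e e0.
  have [a1 qa1 ha1] := hr (x0 + y) ltac:(by rewrite addrAC subrr add0r) e e0.
  have [a2 qa2 ha2] := hr (x0 - y) ltac:(by rewrite addrAC subrr add0r rnormN) e e0.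
  have h2 : rn (emb s 2^-1) = 2^-1 by rewrite rnorm_emb ger0_norm.
  exists (emb s 2^-1 *: (a1 - a2)).
    by rewrite qZ h2; have := qD a1 (- a2); rewrite qN; lra.
  have -> : y - emb s 2^-1 *: (a1 - a2) =
      emb s 2^-1 *: ((x0 + y - a1) - (x0 - y - a2)).
    have -> : (x0 + y - a1) - (x0 - y - a2) = (y + y) - (a1 - a2).
      by rewrite opprD addrACA -opprD opprB [x0 + y]addrC addrACA subrr addr0.
    rewrite [RHS]scalerBr; congr (_ - _); have -> : y + y = (2%:R : K) *: y by rewrite scaler_nat.
    rewrite scalerA.
    by rewrite -(rmorph_nat (emb s)) -rmorphM mulVf// rmorph1 scale1r.
  rewrite rnormZ h2; have := ler_rnormB s (x0 + y - a1) (x0 - y - a2); lra.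
have h2 (t : R) y : 0 < t -> rn y < r * t -> forall eps : R, 0 < eps ->
    exists2 a, q a <= n%:R * t & rn (y - a) < eps.
  move=> t0 yr e e0.
  have tn : rn (emb s t) = t by rewrite rnorm_emb gtr0_norm.
  have tVn : rn (emb s t^-1) = t^-1 by rewrite rnorm_emb gtr0_norm// invr_gt0.
  have tt : emb s t * emb s t^-1 = 1 by rewrite -rmorphM divff ?rmorph1// gt_eqF.
  have [a qa ha] := h1 (emb s t^-1 *: y)
    ltac:(by rewrite rnormZ tVn mulrC ltr_pdivrMr) (e / t) (divr_gt0 e0 t0).
  exists (emb s t *: a); first by rewrite qZ tn mulrC ler_pM2r.
  have -> : y - emb s t *: a = emb s t *: (emb s t^-1 *: y - a).
    by rewrite scalerBr scalerA tt scale1r.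
  by rewrite rnormZ tn mulrC -ltr_pdivlMr.
(* Successive approximation: y is the sum of pieces on which [q] is at most n / 2^k, and countable
   subadditivity adds these bounds. *)
have h3 y : rn y < r -> q y <= n%:R * 2.
  move=> yr.
  have step (t : E * nat) : exists a, rn t.1 < r * 2^-1 ^+ t.2 ->
      q a <= n%:R * 2^-1 ^+ t.2 /\ rn (t.1 - a) < r * 2^-1 ^+ t.2.+1.
    have [h|h] := pselect (rn t.1 < r * 2^-1 ^+ t.2); last by exists 0.
    have [a ? ?] := h2 _ _ (half_pow_gt0 R t.2) h _ (mulr_gt0 r0 (half_pow_gt0 R t.2.+1)).
    by exists a.
  have [f hf] := choice step.
  pose v := fix v k := if k is m.+1 then v m - f (v m, m) else y.
  have hv k : rn (v k) < r * 2^-1 ^+ k.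
    elim: k => [|k IH]; first by rewrite expr0 mulr1.
    by have [] := hf (v k, k) IH.
  have sv k : \sum_(0 <= i < k) f (v i, i) = y - v k.
    elim: k => [|k IH]; first by rewrite big_geq// subrr.
    by rewrite big_nat_recr//= IH opprB addrA addrAC.
  apply: (qS (fun k => f (v k, k))).
    move=> e e0; have [N hN] := half_pow_lt (divr_gt0 e0 r0).
    exists N => k /hN hk; rewrite sv addrAC subrr add0r rnormN.
    by apply: (lt_trans (hv k)); rewrite mulrC -ltr_pdivlMr.
  move=> k; apply: (@le_trans _ _ (\sum_(0 <= i < k) n%:R * 2^-1 ^+ i)).
    by apply: ler_sum => i _; have [] := hf (v i, i) (hv i).
  rewrite -mulr_sumr ler_wpM2l//; have := sum_half_pow_le R 0 k.
  by rewrite expr0 mulr1.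
(* A vector rescaled to norm r / 2 has [q] at most 2n by [h3], whence the factor 4. *)
exists (n%:R * 4 / r) => [|x].
  by rewrite divr_ge0// ?mulr_ge0// ltW.
have [->|x0'] := eqVneq x 0.
  by rewrite rnorm0 -{1}(scale0r (0 : E)) qZ rnorm0 mul0r mulr0.
have xp : 0 < rn x by rewrite lt_neqAle rnorm_ge0 andbT eq_sym rnorm_eq0.
have t0 : 0 < r / (2 * rn x) by rewrite divr_gt0// mulr_gt0.
have tn : rn (emb s (r / (2 * rn x))) = r / (2 * rn x).
  by rewrite rnorm_emb gtr0_norm.
have := h3 (emb s (r / (2 * rn x)) *: x); rewrite rnormZ qZ tn.
have -> : r / (2 * rn x) * rn x = r / 2 by field; rewrite gt_eqF.
move=> /(_ ltac:(lra)).
rewrite mulrC mulrA ler_pdivrMr ?mulr_gt0// => h.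
rewrite mulrAC ler_pdivlMr//; lra.
Qed.

End zabreiko.

(** * Schauder bases *)

Section schauder.
Context {R : realType} {K : numFieldType} (s : real_scalars R K).
Context {E : completeNormedModType K} (e : nat -> E).
Hypothesis he : schauder_basis e.
Local Notation rn := (rnorm s).

Lemma rcauchy_tends_scalar (u : nat -> K) : rcauchy s u -> exists l, tends s u l.
Proof.
move=> uC; have [|l hl] := @scalars_complete _ _ s u; last by exists l.
move=> eps eps0; have [N hN] := uC _ eps0; exists N => m n Nm Nn.
have [mn|/ltnW nm] := leqP m n; last exact: hN.
by rewrite distrC; exact: hN.
Qed.

Definition psum (a : nat -> K) (n : nat) : E := \sum_(0 <= k < n) a k *: e k.

Definition bcoord (x : E) : nat -> K := sval (cid (he x)).

Lemma bcoordP x : tends s (psum (bcoord x)) x.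
Proof. by apply/cvg_tends; rewrite /bcoord; case: (cid (he x)) => a [h _] /=. Qed.

Lemma bcoord_uniq x a : tends s (psum a) x -> bcoord x = a.
Proof. by move=> /cvg_tends h; rewrite /bcoord; case: (cid (he x)) => b [_ hb] /=; exact: hb. Qed.

Lemma bcoord_inj : injective bcoord.
Proof.
by move=> x y xy; have := bcoordP x; rewrite xy => h; exact: tends_uniq h (bcoordP y).
Qed.

Lemma psumS a n : psum a n.+1 = psum a n + a n *: e n.
Proof. by rewrite /psum big_nat_recr. Qed.

Lemma psumD a b n : psum (fun k => a k + b k) n = psum a n + psum b n.
Proof. by rewrite -big_split; apply: eq_bigr => k _; rewrite scalerDl. Qed.

Lemma psumZ c a n : psum (fun k => c * a k) n = c *: psum a n.
Proof. by rewrite scaler_sumr; apply: eq_bigr => k _; rewrite scalerA. Qed.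

Lemma bcoordD x y m : bcoord (x + y) m = bcoord x m + bcoord y m.
Proof.
rewrite (@bcoord_uniq (x + y) (fun k => bcoord x k + bcoord y k))//.
apply: tends_ext (tendsD (bcoordP x) (bcoordP y)) => n.
by rewrite psumD.
Qed.

Lemma bcoordZ c x m : bcoord (c *: x) m = c * bcoord x m.
Proof.
rewrite (@bcoord_uniq (c *: x) (fun k => c * bcoord x k))//.
by apply: tends_ext (tendsZ c (bcoordP x)) => n; rewrite psumZ.
Qed.

Lemma bcoord0 m : bcoord 0 m = 0.
Proof. by rewrite -(scale0r (0 : E)) bcoordZ mul0r. Qed.

Lemma psum_delta m n : (m < n)%N -> psum (fun k => (k == m)%:R) n = e m.
Proof.
move=> mn; rewrite /psum (bigD1_seq m) ?iota_uniq ?mem_index_iota//=.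
rewrite eqxx scale1r big1 ?addr0// => i im; by rewrite (negPf im) scale0r.
Qed.

Lemma bcoord_basis m k : bcoord (e m) k = (k == m)%:R.
Proof.
rewrite (@bcoord_uniq _ (fun k => (k == m)%:R))// => eps e0.
by exists m.+1 => n mn; rewrite psum_delta// subrr rnorm0.
Qed.

Lemma basis_neq0 m : e m != 0.
Proof.
apply/negP => /eqP h; have := bcoord_basis m m; rewrite h bcoord0 eqxx.
by move/eqP; rewrite eq_sym oner_eq0.
Qed.

(** The classical equivalent norm for which the basis is monotone; bounding it by the given norm
    bounds all basis projections at once. *)
Definition basis_norm (x : E) : R := sup (range (fun n => rn (psum (bcoord x) n))).

Lemma le_basis_norm x n : rn (psum (bcoord x) n) <= basis_norm x.
Proof.
apply: ub_le_sup; last by exists n.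
by have [c hc] := tends_bounded (bcoordP x); exists c => _ [m _ <-].
Qed.

Lemma basis_norm_le x c : (forall n, rn (psum (bcoord x) n) <= c) -> basis_norm x <= c.
Proof.
move=> h; apply: ge_sup; first by exists (rn (psum (bcoord x) 0)), 0%N.
by move=> _ [n _ <-].
Qed.

Lemma basis_norm_coord x n : rn (bcoord x n *: e n) <= 2 * basis_norm x.
Proof.
have -> : bcoord x n *: e n = psum (bcoord x) n.+1 - psum (bcoord x) n.
  by rewrite psumS addrAC subrr add0r.
have := ler_rnormB s (psum (bcoord x) n.+1) (psum (bcoord x) n).
have := le_basis_norm x n; have := le_basis_norm x n.+1; lra.
Qed.

(** The coordinates of the [u k] are dominated by [basis_norm (u k)], hence have convergent sums
    [b m]; the tails are small uniformly in the length of the partial sums, so the two limits can be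
    exchanged and [b] is the expansion of [x]. *)
Lemma basis_norm_countably_subadditive (u : nat -> E) x c :
  tends s (fun n => \sum_(0 <= k < n) u k) x ->
  (forall n, \sum_(0 <= k < n) basis_norm (u k) <= c) -> basis_norm x <= c.
Proof.
move=> ux uc.
have ep m : 0 < rn (e m).
  by rewrite lt_neqAle rnorm_ge0 andbT eq_sym rnorm_eq0 basis_neq0.
have cb m : exists b, tends s (fun n => \sum_(0 <= k < n) bcoord (u k) m) b.
  apply: rcauchy_tends_scalar.
  apply: (@rcauchy_sum _ _ s _ _ (fun k => 2 * basis_norm (u k) / rn (e m))
            (2 * c / rn (e m))) => n.
    by rewrite ler_pdivlMr// -rnormZ basis_norm_coord.
  by rewrite -mulr_suml -mulr_sumr ler_pM2r ?invr_gt0// ler_wpM2l.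
have [b hb] := choice cb.
have psb n : tends s (fun m => \sum_(0 <= k < m) psum (bcoord (u k)) n) (psum b n).
  elim: n => [|n IH].
    apply: tends_ext (tends_cst s _) => m; rewrite /psum big_geq// big1// => k _.
    by rewrite big_geq.
  have := tendsD IH (tendsZl (e n) (hb n)).
  rewrite -psumS; apply: tends_ext => m.
  by rewrite scaler_suml -big_split; apply: eq_bigr => k _; rewrite psumS.
have psle n : rn (psum b n) <= c.
  apply: (tends_le (psb n)) => m; apply: (le_trans (ler_rnorm_sum _ _ _ _)).
  by apply: le_trans (uc m); apply: ler_sum => k _; exact: le_basis_norm.
(* Three comparisons at a fixed number m of vectors: the tail of the partial sums, uniform in n; the
   expansion of a finite sum; the tail of the vectors themselves. *)
have psx : tends s (psum b) x.
  move=> eps eps0.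
  have q0 k : rn (u k) <= basis_norm (u k).
    exact: tends_le (bcoordP (u k)) (le_basis_norm (u k)).
  have e3 : 0 < eps / 4 by rewrite divr_gt0.
  have qq k : rnorm s (emb s (basis_norm (u k))) <= basis_norm (u k).
    by rewrite rnorm_emb ger0_norm//; exact: le_trans (rnorm_ge0 s _) (q0 k).
  have [N1 hN1] := rcauchy_sum qq uc e3.
  have [N2 hN2] := ux _ e3.
  pose m := maxn N1 N2.
  have tm : tends s (fun n => \sum_(0 <= k < m) psum (bcoord (u k)) n)
                    (\sum_(0 <= k < m) u k).
    elim: m => [|m IH].
      apply: tends_ext (tends_cst s _) => n; by rewrite !big_geq.
    rewrite big_nat_recr//=; apply: tends_ext (tendsD IH (bcoordP (u m))) => n.
    by rewrite big_nat_recr.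
  have [N3 hN3] := tm _ e3.
  exists N3 => n /hN3 h3.
  have h2 := hN2 m (leq_maxr _ _).
  have h1 : rn (psum b n - \sum_(0 <= k < m) psum (bcoord (u k)) n) <= eps / 4.
    apply: (tends_le_eventually (N0 := m)
      (tendsB (psb n) (tends_cst s (\sum_(0 <= k < m) psum (bcoord (u k)) n)))).
    move=> M mM; rewrite sum_natB//; apply: le_trans (ltW (hN1 m M (leq_maxl _ _) mM)).
    rewrite sum_natB// -rmorph_sum rnorm_emb ger0_norm; last first.
      by apply: sumr_ge0 => k _; exact: le_trans (rnorm_ge0 s _) (q0 k).
    apply: (le_trans (ler_rnorm_sum _ _ _ _)).
    by apply: ler_sum => k _; exact: le_basis_norm.
  have := ler_rdistD s (\sum_(0 <= k < m) psum (bcoord (u k)) n) (psum b n) x.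
  have := ler_rdistD s (\sum_(0 <= k < m) u k) (\sum_(0 <= k < m) psum (bcoord (u k)) n) x.
  lra.
by apply: basis_norm_le => n; rewrite (bcoord_uniq psx).
Qed.

Lemma psum_coord_bounded : exists2 M, 0 <= M & forall x n, rn (psum (bcoord x) n) <= M * rn x.
Proof.
have [||||M M0 hM] := @countably_subadditive_bounded _ _ s E basis_norm.
- by move=> x; exact: le_trans (rnorm_ge0 s _) (le_basis_norm x 0).
- move=> x y; apply: basis_norm_le => n.
  rewrite (_ : bcoord (x + y) = fun k => bcoord x k + bcoord y k); last first.
    by apply/funext => k; rewrite bcoordD.
  rewrite psumD; apply: (le_trans (ler_rnormD _ _ _)).
  by rewrite lerD// le_basis_norm.
- move=> a x; have le1 b y : basis_norm (b *: y) <= rn b * basis_norm y.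
    apply: basis_norm_le => n.
    rewrite (_ : bcoord (b *: y) = fun k => b * bcoord y k); last first.
      by apply/funext => k; rewrite bcoordZ.
    by rewrite psumZ rnormZ ler_wpM2l ?rnorm_ge0// le_basis_norm.
  have [->|a0] := eqVneq a 0.
    rewrite rnorm0 mul0r; apply/eqP; rewrite eq_le.
    rewrite (le_trans (rnorm_ge0 s (psum (bcoord (0 *: x)) 0)) (le_basis_norm _ 0)) andbT.
    by apply: (le_trans (le1 _ _)); rewrite rnorm0 mul0r.
  apply/eqP; rewrite eq_le le1/=.
  have ap : 0 < rn a by rewrite lt_neqAle rnorm_ge0 andbT eq_sym rnorm_eq0.
  rewrite -ler_pdivlMl//; have := le1 a^-1 (a *: x).
  rewrite scalerA mulVf// scale1r => h; apply: (le_trans h).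
  by rewrite rnormV.
- exact: basis_norm_countably_subadditive.
exists M => // x n; exact: le_trans (le_basis_norm x n) (hM x).
Qed.

Lemma bcoord_bounded m : exists2 C, 0 < C & forall x, rn (bcoord x m) <= C * rn x.
Proof.
have [M M0 hM] := psum_coord_bounded.
have ep : 0 < rn (e m).
  by rewrite lt_neqAle rnorm_ge0 andbT eq_sym rnorm_eq0 basis_neq0.
exists ((2 * M + 1) / rn (e m)); first by rewrite divr_gt0//; lra.
move=> x; rewrite mulrAC ler_pdivlMr// -rnormZ.
apply: (@le_trans _ _ (2 * M * rn x)); last first.
  rewrite ler_wpM2r ?rnorm_ge0//; lra.
have -> : bcoord x m *: e m = psum (bcoord x) m.+1 - psum (bcoord x) m.
  by rewrite psumS addrAC subrr add0r.
have := ler_rnormB s (psum (bcoord x) m.+1) (psum (bcoord x) m).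
have := hM x m; have := hM x m.+1; lra.
Qed.

Lemma bcoordB x y m : bcoord (x - y) m = bcoord x m - bcoord y m.
Proof. by rewrite bcoordD -scaleN1r bcoordZ mulN1r. Qed.

Lemma tends_coord (u : nat -> E) x m :
  tends s u x -> tends s (fun n => bcoord (u n) m) (bcoord x m).
Proof.
move=> ux eps eps0; have [C C0 hC] := bcoord_bounded m.
have [N hN] := ux _ (divr_gt0 eps0 C0); exists N => n /hN.
rewrite ltr_pdivlMr// mulrC -bcoordB; exact: le_lt_trans.
Qed.

(** A closed graph argument: if the vectors L u_k have summable norms, their sum must be L x,
    because coordinates are continuous and determine the vector. *)
Lemma coordinatewise_bounded (L : E -> E) (t : nat -> nat) (o : nat -> bool) :
  (forall x m, bcoord (L x) m = (o m)%:R * bcoord x (t m)) ->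
  exists2 M, 0 <= M & forall x, rn (L x) <= M * rn x.
Proof.
move=> hL.
have LD x y : L (x + y) = L x + L y.
  by apply: bcoord_inj; apply/funext => m; rewrite bcoordD !hL bcoordD mulrDr.
have LZ a x : L (a *: x) = a *: L x.
  by apply: bcoord_inj; apply/funext => m; rewrite bcoordZ !hL bcoordZ mulrCA.
have Lsum (u : nat -> E) n : L (\sum_(0 <= k < n) u k) = \sum_(0 <= k < n) L (u k).
  elim: n => [|n IH]; first by rewrite !big_geq// -{1}(scale0r (0 : E)) LZ scale0r.
  by rewrite !big_nat_recr//= LD IH.
apply: (@countably_subadditive_bounded _ _ s E (rn \o L)) => /=.
- by move=> x; exact: rnorm_ge0.
- by move=> x y; rewrite LD ler_rnormD.
- by move=> a x; rewrite LZ rnormZ.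
move=> u x c ux uc.
have [v hv vc] := tends_sum_abs (fun k => lexx (rn (L (u k)))) uc.
suff -> : L x = v by [].
apply: bcoord_inj; apply/funext => m.
apply: (tends_uniq (s := s) (u := fun n => bcoord (L (\sum_(0 <= k < n) u k)) m)); last first.
  by apply: tends_coord; apply: tends_ext hv => n; rewrite Lsum.
have := tendsZ ((o m)%:R) (tends_coord (t m) ux).
by rewrite hL; apply: tends_ext => n; rewrite hL.
Qed.

End schauder.

Lemma block_index (phi : nat -> nat) (phi0 : phi 0%N = 0%N)
  (phiS : forall k, (phi k < phi k.+1)%N) :
  exists blk : nat -> nat, forall i k,
    (phi k <= i < phi k.+1)%N = (blk i == k).
Proof.
have phim j k : (j <= k)%N -> (phi j <= phi k)%N.
  move=> jk; rewrite -(subnK jk); elim: (k - j)%N => [|d IH]//=.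
  by rewrite addSn; apply: (leq_trans IH); exact: ltnW.
have ex i : exists k, (phi k <= i < phi k.+1)%N.
  elim: i => [|i [k /andP[h1 h2]]].
    by exists 0%N; rewrite phi0 leqnn -[X in (X < _)%N]phi0 phiS.
  have [h|h] := ltnP i.+1 (phi k.+1); first by exists k; rewrite h (leq_trans h1).
  exists k.+1; rewrite h/=; have := phiS k.+1; lia.
have [blk hblk] := choice ex.
exists blk => i k; apply/idP/eqP => [h|<-//].
have := hblk i; apply: contraTeq; rewrite neq_ltn => /orP[/phim|/phim]; lia.
Qed.

(** * Operators given by sub-symmetry *)

Section subsymmetric.
Context {R : realType} {K : numFieldType} (s : real_scalars R K).
Context {E : completeNormedModType K}.
Local Notation rn := (rnorm s).

(* A failure of the Cauchy criterion along the odd terms occurs in infinitely many blocks; the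
   permutation listing the odd indices in order, with the k-th even index inserted after the k-th
   block, then breaks the Cauchy criterion of the rearranged series. *)
Lemma odd_subseries_cvg (u : nat -> E) : unconditionally_convergent u ->
  exists l, tends s (fun n => \sum_(0 <= k < n) u k.*2.+1) l.
Proof.
move=> uc; apply: rcauchy_tends; apply: contrapT => hno.
have [d [d0 hd]] : exists d : R, 0 < d /\ forall N, exists pq : nat * nat,
   [/\ (N <= pq.1)%N, (pq.1 <= pq.2)%N & d <= rn (\sum_(pq.1 <= k < pq.2) u k.*2.+1)].
  apply: contrapT => h; apply: hno => e e0; apply: contrapT => h2; apply: h.
  exists e; split => // N; apply: contrapT => h3; apply: h2; exists N => m n Nm mn.
  rewrite sum_natB// ltNge; apply/negP => h4; apply: h3; by exists (m, n).
have [f hf] := choice hd.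
(* Each block contains a stretch of odd terms whose sum has norm at least d; the successor keeps the
   blocks nonempty. *)
pose phi := fix phi k := if k is j.+1 then (f (phi j)).2.+1 else 0%N.
have phiS k : (phi k < phi k.+1)%N.
  by have [h1 h2 _] := hf (phi k); rewrite /= ltnS (leq_trans h1).
have [blk hblk] := block_index (erefl : phi 0%N = 0%N) phiS.
have chiS k : (phi k + k < phi k.+1 + k.+1)%N by have := phiS k; lia.
(* The k-th block of positions is block k of odd terms, moved by the k even terms already inserted,
   with one more slot at its end for the index [k.*2]. *)
have [cblk hcblk] := @block_index (fun k => phi k + k)%N erefl chiS.
pose t n := let k := cblk n in if n == (phi k.+1 + k)%N then k.*2 else (n - k).*2.+1.
pose t' j := if odd j then (j./2 + blk j./2)%N else (phi (j./2).+1 + j./2)%N.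
have todd i k : (phi k <= i < phi k.+1)%N -> t (i + k)%N = i.*2.+1.
  move=> h; rewrite /t (_ : cblk _ = k); last by apply/eqP; rewrite -hcblk; lia.
  by rewrite addnK ifF//; apply/negP => /eqP; lia.
have teven k : t (phi k.+1 + k)%N = k.*2.
  by rewrite /t (_ : cblk _ = k) ?eqxx//; apply/eqP; rewrite -hcblk; have := phiS k; lia.
have tb : bijective t.
  exists t' => n.
    rewrite /t; set k := cblk n.
    have : (phi k + k <= n < phi k.+1 + k.+1)%N by rewrite hcblk.
    have [-> _|nk h] := eqVneq n (phi k.+1 + k)%N.
      by rewrite /t' odd_double doubleK.
    rewrite /t' /= odd_double/= uphalf_double.
    have /eqP -> : blk (n - k)%N == k by rewrite -hblk; lia.
    lia.
  rewrite /t'; case: ifPn => [oj|oj].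
    rewrite todd ?hblk//; lia.
  by rewrite teven; lia.
have /(cvgn_tends s)[l hl] := uc t tb.
have [N hN] := tends_cauchy hl d0.
(* This stretch lies in block N, so it occupies the consecutive positions from p + N to q + N and
   contradicts the Cauchy criterion. *)
set p := (f (phi N)).1; set q := (f (phi N)).2.
have [h1 h2 h4] := hf (phi N).
have := hN (p + N)%N (q + N)%N (leq_addl _ _) ltac:(by rewrite leq_add2r).
rewrite /series/= sum_natB ?leq_add2r// big_addn addnK ltNge => /negP h3.
apply: h3; apply: (le_trans h4).
rewrite [leLHS](_ : _ = rn (\sum_(p <= i < q) u (t (i + N)%N)))//.
congr rn; apply: eq_big_nat => i /andP[pi iq]; rewrite todd//.
by rewrite (leq_trans h1)//= ltnS ltnW.
Qed.

Context (e : nat -> E) (he : schauder_basis e).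

(** Unconditionality makes the odd part of an expansion converge, and the equivalence of e with its
    odd subsequence carries it over to the whole basis. *)
Lemma subsymmetric_odd_restriction : subsymmetric_basis e ->
  exists D : E -> E, forall x m, bcoord he (D x) m = bcoord he x m.*2.+1.
Proof.
move=> [[_ unc] sub].
suff : forall x, exists y, bcoord he y = fun m => bcoord he x m.*2.+1.
  by move=> /choice[D hD]; exists D => x m; rewrite hD.
move=> x; have /odd_subseries_cvg[l hl] := unc x (bcoord he x) ltac:(exact/(cvg_tends s)/bcoordP).
have h : {homo (fun m => m.*2.+1) : m n / (m < n)%N} by move=> m n; lia.
have : cvgn (basis_series e (fun m => bcoord he x m.*2.+1)).
  by apply/(sub _ h)/(cvgn_tends s); exists l.
move=> /(cvgn_tends s)[y hy]; exists y; exact: (bcoord_uniq he hy).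
Qed.

(** The same equivalence in the opposite direction. Boundedness of this operator controls the growth
    of |e_{2m+1}| against |e_m|. *)
Lemma subsymmetric_odd_spread : subsymmetric_basis e ->
  exists S : E -> E, forall x m, bcoord he (S x) m = (odd m)%:R * bcoord he x m./2.
Proof.
move=> [_ sub].
suff : forall x, exists y, bcoord he y = fun m => (odd m)%:R * bcoord he x m./2.
  by move=> /choice[S hS]; exists S => x m; rewrite hS.
move=> x.
have h : {homo (fun m => m.*2.+1) : m n / (m < n)%N} by move=> m n; lia.
have : cvgn (basis_series (e \o (fun m => m.*2.+1)) (bcoord he x)).
  by apply/(sub _ h)/(cvgn_tends s); exists x; exact: bcoordP.
move=> /(cvgn_tends s)[y hy]; exists y; apply: (bcoord_uniq (s := s) he).
have -> : psum e (fun m => (odd m)%:R * bcoord he x m./2) =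
    basis_series (e \o (fun m => m.*2.+1)) (bcoord he x) \o half.
  apply/funext => n; elim: n => [|n IH]; first by rewrite /psum /= /basis_series /series/= !big_geq.
  rewrite psumS IH /= uphalf_half; have [oj|oj] := boolP (odd n).
    rewrite mul1r add1n /basis_series /series/= big_nat_recr//=.
    by rewrite -[in RHS](_ : n = n./2.*2.+1)//; lia.
  by rewrite mul0r scale0r addr0 add0n.
move=> eps /hy[N hN]; exists N.*2 => n nN; apply: hN; lia.
Qed.

End subsymmetric.

(** * Retraction onto a complemented copy *)

Section complemented.
Context {R : realType} {K : numFieldType} (s : real_scalars R K).
Local Notation rn := (rnorm s).

Lemma bounded_rnorm (E F : normedZmodType K) (f : E -> F) (M : K) :
  (forall x, `|f x| <= M * `|x|) ->
  exists2 C, 0 <= C & forall x, rn (f x) <= C * rn x.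
Proof.
move=> h; exists (rn M); first exact: rnorm_ge0.
move=> x; rewrite -(ler_emb s) rmorphM !emb_rnorm -[X in _ * X]normr_id -normrM.
by rewrite ger0_norm//; apply: le_trans (h x).
Qed.

Context {Z E : completeNormedModType K}.

(** [U] is the projection onto S followed by the inverse of [J]; equivalently, U z is the only u
    with z - J u in Y, and linearity follows from this uniqueness. *)
Lemma complemented_copy_retraction : complemented_copy E Z ->
  exists (J : {linear E -> Z}) (U : Z -> E),
  [/\ forall (a : K) x y, U (a *: x + y) = a *: U x + U y,
      forall u, U (J u) = u,
      exists2 C, 0 <= C & forall u, rn (J u) <= C * rn u &
      exists2 C, 0 <= C & forall z, rn (U z) <= C * rn z].
Proof.
move=> [S [Y [[[Sc S0 Slin] [Yc Y0 Ylin] SY dec [C1 hC1]] [J [[M hM] JS [C2 hC2]]]]]].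
exists J.
have [C C0 hC] : exists2 C, 0 <= C & forall u, rn u <= C * rn (J u).
  exists (rn C2); first exact: rnorm_ge0.
  move=> x; rewrite -(ler_emb s) rmorphM !emb_rnorm -[X in _ * X]normr_id -normrM.
  by rewrite ger0_norm//; apply: le_trans (hC2 x).
have [U hU] : exists U : Z -> E, forall z, Y (z - J (U z)).
  suff : forall z, exists u, Y (z - J u) by move=> /choice[U hU]; exists U.
  move=> z; have [x [y [Sx Yy ->]]] := dec z.
  by move: Sx; rewrite -JS => -[u _ <-]; exists u; rewrite addrAC subrr add0r.
have YN y : Y y -> Y (- y) by move=> h; rewrite -scaleN1r -[_ *: _]addr0; exact: Ylin.
have YB x y : Y x -> Y y -> Y (x - y).
  by move=> h1 /YN h2; rewrite -[x]scale1r; exact: Ylin.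
have uniq z u : Y (z - J u) -> U z = u.
  move=> h; apply/eqP; rewrite -subr_eq0 -(rnorm_eq0 s) eq_le rnorm_ge0 andbT.
  suff : J (U z - u) = 0 by move=> e; apply: (le_trans (hC _)); rewrite e rnorm0 mulr0.
  suff : (S `&` Y) (J (U z - u)) by rewrite SY.
  split; first by rewrite -JS; exists (U z - u).
  have -> : J (U z - u) = (z - J u) - (z - J (U z)).
    by rewrite opprB [RHS]addrC addrA subrK linearB.
  exact: YB.
have [D D0 hD] : exists2 D, 0 <= D & forall z, rn (J (U z)) <= D * rn z.
  apply: (@bounded_rnorm _ _ (J \o U) C1) => z /=.
  have SJ : S (J (U z)) by rewrite -JS; exists (U z).
  by have := hC1 _ _ SJ (hU z); rewrite addrC subrK.
exists U; split.
- move=> a x y; apply: uniq; rewrite linearP opprD addrACA -scalerBr.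
  exact: Ylin (hU x) (hU y).
- by move=> u; apply: uniq; rewrite subrr.
- exact: bounded_rnorm hM.
- exists (C * D); first exact: mulr_ge0.
  by move=> z; apply: (le_trans (hC _)); rewrite -mulrA ler_wpM2l.
Qed.

Lemma separable_dense_sequence : separable Z ->
  exists zeta : nat -> Z, forall z (eps : R), 0 < eps ->
    exists k, rn (z - zeta k) < eps.
Proof.
move=> [D cD dD].
have /countable_injP[f fI] := cD.
have h k : exists z, forall d, D d -> f d = k -> z = d.
  have [[d [Dd dk]]|h] := pselect (exists d, D d /\ f d = k).
    by exists d => d' Dd' d'k; apply: fI; rewrite ?inE// dk d'k.
  by exists 0 => d Dd dk; exfalso; apply: h; exists d.
have [zeta hz] := choice h.
exists zeta => z eps e0.
have [|d [/= dz Dd]] := dD _ _ (rball_open s z eps).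
  by exists z => /=; rewrite subrr rnorm0.
by exists (f d); rewrite (hz _ d)// rdistC.
Qed.

End complemented.

(** * The operator and its chains *)

Section chains.
Context {R : realType} {K : numFieldType} (s : real_scalars R K).
Context {Z : completeNormedModType K}.
Local Notation rn := (rnorm s).
Implicit Types (A : Z -> Z) (l : Z -> K) (c : nat -> Z).

(* As l0 and l1 vanish at c n for n > 0, a sum \sum_n c_n n over various chains c_n takes under
   l0 and l1 the same values as its first term c_0 0. *)
Record chain A l0 l1 c : Prop := Chain {
  chain0 : A (c 0%N) = 0;
  chainS : forall n, A (c n.+1) = c n;
  chain_l0 : forall n, l0 (c n.+1) = 0;
  chain_l1 : forall n, l1 (c n.+1) = 0;
  chain_bound : exists2 M, 0 <= M & forall n, rn (c n) <= M * 4^-1 ^+ n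
}.

Definition lin (V W : normedModType K) (f : V -> W) :=
  forall a x y, f (a *: x + y) = a *: f x + f y.

Lemma lin0 (V W : normedModType K) (f : V -> W) : lin f -> f 0 = 0.
Proof.
by move=> h; have := h (-1) 0 0; rewrite scaler0 (addr0 (0 : V)) scaleN1r addNr.
Qed.

Lemma linZ (V W : normedModType K) (f : V -> W) a x : lin f -> f (a *: x) = a *: f x.
Proof. by move=> h; have := h a x 0; rewrite (lin0 h) !addr0. Qed.

Lemma linD (V W : normedModType K) (f : V -> W) x y : lin f -> f (x + y) = f x + f y.
Proof. by move=> h; have := h 1 x y; rewrite !scale1r. Qed.

Lemma linB (V W : normedModType K) (f : V -> W) x y : lin f -> f (x - y) = f x - f y.
Proof. by move=> h; rewrite linD// -scaleN1r linZ// scaleN1r. Qed.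

Lemma chain_lin A (l0 l1 : Z -> K^o) a c d : lin A -> lin l0 -> lin l1 ->
  chain A l0 l1 c -> chain A l0 l1 d -> chain A l0 l1 (fun n => a *: c n + d n).
Proof.
move=> hA h0 h1 [c0 cS cl0 cl1 [M M0 hM]] [d0 dS dl0 dl1 [M' M'0 hM']]; split.
- by rewrite hA c0 d0 scaler0 addr0.
- by move=> n; rewrite hA cS dS.
- by move=> n; rewrite h0 cl0 dl0 scaler0 addr0.
- by move=> n; rewrite h1 cl1 dl1 scaler0 addr0.
exists (rn a * M + M'); first by rewrite addr_ge0// mulr_ge0// rnorm_ge0.
move=> n; apply: (le_trans (ler_rnormD _ _ _)).
by rewrite mulrDl lerD// rnormZ -mulrA ler_wpM2l// rnorm_ge0.
Qed.

Lemma chain_cst0 A (l0 l1 : Z -> K^o) : lin A -> lin l0 -> lin l1 ->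
  chain A l0 l1 (fun=> 0).
Proof.
move=> hA h0 h1; split; rewrite ?(lin0 hA) ?(lin0 h0) ?(lin0 h1)//.
by exists 0 => // n; rewrite rnorm0 mul0r.
Qed.

(** The diagonal sum in [word_value] is what phi(x) retains of N letters read at times 0, ..., N-1:
    the letter read at time i enters through its i-th element. Padding by zero chains lets words of
    different lengths be added. *)
Definition chain_word A l0 l1 (N : nat) (cs : nat -> nat -> Z) :=
  (forall i, chain A l0 l1 (cs i)) /\ forall i m, (N <= i)%N -> cs i m = 0.

Definition word_value A l0 l1 z := exists N cs,
  chain_word A l0 l1 N cs /\ z = \sum_(0 <= i < N) cs i i.

Lemma word_value_lin A (l0 l1 : Z -> K^o) a x y : lin A -> lin l0 -> lin l1 ->
  word_value A l0 l1 x -> word_value A l0 l1 y -> word_value A l0 l1 (a *: x + y).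
Proof.
move=> hA h0 h1 [N [cs [[hc hc0] ->]]] [M [ds [[hd hd0] ->]]].
exists (maxn N M), (fun i m => a *: cs i m + ds i m); split.
  split; first by move=> i; exact: chain_lin.
  move=> i m; rewrite geq_max => /andP[Ni Mi].
  by rewrite hc0// hd0// scaler0 addr0.
have pad n m (f : nat -> Z) : (n <= m)%N -> (forall i, (n <= i)%N -> f i = 0) ->
    \sum_(0 <= i < m) f i = \sum_(0 <= i < n) f i.
  move=> nm f0; rewrite (big_cat_nat (leq0n n) nm)/= [X in _ + X]big_nat.
  by rewrite [X in _ + X]big1 ?addr0// => i /andP[/f0].
rewrite big_split/= -scaler_sumr (pad N (maxn N M)) ?leq_maxl//; last by move=> i; exact: hc0.
by rewrite (pad M (maxn N M)) ?leq_maxr// => i; exact: hd0.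
Qed.

(** Take the chain as the letter at time n, preceded by zero letters. *)
Lemma word_value_chain A (l0 l1 : Z -> K^o) c n : lin A -> lin l0 -> lin l1 ->
  chain A l0 l1 c -> word_value A l0 l1 (c n).
Proof.
move=> hA h0 h1 hc.
exists n.+1, (fun i => if i == n then c else fun=> 0); split.
  split; first by move=> i; case: eqP => // _; exact: chain_cst0.
  by move=> i m; case: eqP => // ->; rewrite ltnn.
rewrite big_nat_recr//= eqxx big_nat big1 ?add0r// => i /andP[_ h].
by rewrite ifF//; apply/negP => /eqP hi; rewrite hi ltnn in h.
Qed.

Lemma operator_with_chains : separable Z -> complemented_subsymmetric Z ->
  exists (A : {linear Z -> Z}) (l0 l1 : Z -> K^o) (h0 h1 : nat -> Z),
  [/\ bounded_operator A,
      [/\ lin l0, lin l1 & (exists2 C, 0 <= C &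
         forall z, rn (l0 z : K) <= C * rn z /\ rn (l1 z : K) <= C * rn z)],
      [/\ chain A l0 l1 h0, chain A l0 l1 h1, l0 (h0 0%N) = 1 /\ l1 (h0 0%N) = 0 &
         l0 (h1 0%N) = 0 /\ l1 (h1 0%N) = 1] &
      forall z (eps : R), 0 < eps ->
        exists2 w, word_value A l0 l1 w & rn (z - w) < eps].
Proof.
move=> sepZ [E [_ [e eS] ccE]].
have he : schauder_basis e by case: eS => -[].
have [J [U [linU UJ [MJ MJ0 hMJ] [MU MU0 hMU]]]] := complemented_copy_retraction s ccE.
have [zeta hz] := separable_dense_sequence s sepZ.
have [D hD] := subsymmetric_odd_restriction s he eS.
have [S hS] := subsymmetric_odd_spread s he eS.
have [MD MD0 hMD] : exists2 M, 0 <= M & forall x, rn (D x) <= M * rn x.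
  apply: (@coordinatewise_bounded _ _ s E e he D (fun m => m.*2.+1) xpredT).
  by move=> x m; rewrite hD mul1r.
have [MS MS0 hMS] := coordinatewise_bounded s hS.
have linD' : lin D.
  move=> a x y; apply: (@bcoord_inj _ _ s _ _ he); apply/funext => m.
  by rewrite (bcoordD s) (bcoordZ s) !hD (bcoordD s) (bcoordZ s).
have linJ : lin J by move=> a x y; rewrite linearP.
have Sbasis m : S (e m) = e m.*2.+1.
  apply: (@bcoord_inj _ _ s _ _ he); apply/funext => k.
  rewrite hS !(bcoord_basis s); have [ok|ok] := boolP (odd k).
    rewrite mul1r; congr (_%:R); congr nat_of_bool; apply/eqP/eqP; lia.
  by rewrite mul0r; case: eqP => // h; move: ok; rewrite h /= odd_double.
(* Growth rate of the norms along m -> 2m+1; the added 1 gives strict positivity. *)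
pose C := MS + 1.
have C0 : 0 < C by rewrite /C; lra.
have eC m : rn (e m.*2.+1) <= C * rn (e m).
  rewrite -Sbasis; apply: (le_trans (hMS _)); rewrite ler_wpM2r ?rnorm_ge0//.
  by rewrite /C; lra.
pose a m z : K := bcoord he (U z) m.
have lina m : lin (fun z => a m z : K^o).
  by move=> b x y; rewrite /a linU (bcoordD s) (bcoordZ s).
have [Ca hCa] : exists Ca : nat -> R, forall m, 0 < Ca m /\ forall z, rn (a m z) <= Ca m * rn z.
  suff : forall m, exists c : R, 0 < c /\ forall z, rn (a m z) <= c * rn z.
    by move=> /choice[f hf]; exists f.
  move=> m; have [c c0 hc] := bcoord_bounded s he m.
  exists (c * (MU + 1)); split; first by rewrite mulr_gt0//; lra.
  move=> z; apply: (le_trans (hc _)); rewrite -mulrA ler_wpM2l ?(ltW c0)//.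
  apply: (le_trans (hMU _)); rewrite ler_wpM2r ?rnorm_ge0//; lra.
(* The projections of a dense sequence to the kernel of [U], that is, to Y. *)
pose y k := zeta k - J (U (zeta k)).
have Uy k : U (y k) = 0.
  by rewrite /y (linB _ _ linU) UJ subrr.
(* Chosen to make the k-th term of the series [G] below at most 2^-k |z|. *)
pose eps k : R := 2^-1 ^+ k / (Ca k.*2 * (1 + rn (y k.-2))).
have dpos k : 0 < Ca k.*2 * (1 + rn (y k.-2)).
  by rewrite mulr_gt0//; [case: (hCa k.*2) | have := rnorm_ge0 s (y k.-2); lra].
have eps0 k : 0 < eps k by rewrite divr_gt0// half_pow_gt0.
(* The indices k = 0, 1 are reserved: A kills e_0 and e_2, so the chains starting there have heads
   seen by the coordinates 0 and 2. The vectors of Y come from k = 2 on. *)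
pose eta k := if (k < 2)%N then 0 else emb s (eps k) *: y k.-2.
have Ueta k : U (eta k) = 0.
  rewrite /eta; case: ifP => _; first exact: lin0.
  by rewrite (linZ _ _ linU) Uy scaler0.
have etaB z k : rn (a k.*2 z *: eta k) <= 2^-1 ^+ k * rn z.
  have zg := rnorm_ge0 s z; have hg := half_pow_gt0 R k.
  rewrite /eta; case: ifP => _; first by rewrite scaler0 rnorm0 mulr_ge0// ltW.
  rewrite !rnormZ rnorm_emb (gtr0_norm (eps0 k)).
  apply: (@le_trans _ _ ((Ca k.*2 * rn z) * (eps k * (1 + rn (y k.-2))))).
    apply: ler_pM; rewrite ?rnorm_ge0//.
    - by rewrite mulr_ge0 ?rnorm_ge0// ltW.
    - by case: (hCa k.*2).
    - rewrite ler_wpM2l//; first exact: ltW.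
      by rewrite lerDr.
  rewrite le_eqVlt; apply/orP; left; apply/eqP; rewrite /eps.
  have := dpos k; have [] := hCa k.*2; move=> h1 _ h2.
  field; rewrite (gt_eqF h1)/= gt_eqF//; have := rnorm_ge0 s (y k.-2); lra.
have [G hG] : exists G : Z -> Z, forall z,
    tends s (fun n => \sum_(0 <= k < n) a k.*2 z *: eta k) (G z) /\ rn (G z) <= 2 * rn z.
  suff : forall z, exists g,
      tends s (fun n => \sum_(0 <= k < n) a k.*2 z *: eta k) g /\ rn g <= 2 * rn z.
    by move=> /choice[f hf]; exists f.
  move=> z; have [|g hg gB] := tends_sum_abs (etaB z) (c := 2 * rn z); last by exists g.
  move=> n; rewrite -mulr_suml ler_wpM2r ?rnorm_ge0//.
  by have := sum_half_pow_le R 0 n; rewrite expr0 mulr1.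
have linG : lin G.
  move=> b x z; apply: (tends_uniq (s := s) (hG (b *: x + z)).1).
  apply: tends_ext (tendsD (tendsZ b (hG x).1) (hG z).1) => n.
  rewrite scaler_sumr -big_split/=; apply: eq_bigr => k _.
  by rewrite scalerA -scalerDl; congr (_ *: _); rewrite lina.
(* Dividing by [lam] at each backward step absorbs the growth C of the basis vectors and leaves the
   decay 1/4. *)
pose lam := emb s (4 * C).
have lam0 : lam != 0 by rewrite -(rnorm_eq0 s) rnorm_emb normr_eq0 gt_eqF// mulr_gt0.
pose A0 z := lam *: J (D (U z)) + G z.
have linA : lin A0.
  move=> b x z; rewrite /A0 linU linD' linJ linG !scalerDr !scalerA [b * lam]mulrC.
  by rewrite addrACA.
pose A : {linear Z -> Z} := HB.pack A0 (GRing.isLinear.Build K Z Z *:%R A0 linA).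
have aJ m k : a m (J (e k)) = (m == k)%:R by rewrite /a UJ (bcoord_basis s).
have GU0 z : (forall k, a k.*2 z = 0) -> G z = 0.
  move=> h; apply: (tends_uniq (s := s) (hG z).1).
  apply: tends_ext (tends_cst s 0) => n.
  by rewrite big1// => k _; rewrite h scale0r.
have A_U0 z : U z = 0 -> A z = 0.
  move=> h; rewrite /A/= /A0 h (lin0 linD') (lin0 linJ) scaler0 add0r GU0// => k.
  by rewrite /a h (bcoord0 s).
have A_odd m : A (J (e m.*2.+1)) = lam *: J (e m).
  rewrite /A/= /A0 UJ GU0 ?addr0; last first.
    by move=> k; rewrite aJ; case: eqP => // h; have := congr1 odd h; rewrite /= !odd_double.
  congr (_ *: J _); apply: (@bcoord_inj _ _ s _ _ he); apply/funext => k.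
  rewrite hD !(bcoord_basis s); congr (_%:R); congr nat_of_bool; apply/eqP/eqP; lia.
have A_even k : A (J (e k.*2)) = eta k.
  rewrite /A/= /A0 UJ.
  have -> : D (e k.*2) = 0.
    apply: (@bcoord_inj _ _ s _ _ he); apply/funext => m.
    rewrite hD (bcoord_basis s) (bcoord0 s); case: eqP => // h.
    by have := congr1 odd h; rewrite /= !odd_double.
  rewrite (lin0 linJ) scaler0 add0r; apply: (tends_uniq (s := s) (hG _).1) => ep ep0.
  exists k.+1 => n kn; rewrite (bigD1_seq k) ?iota_uniq ?mem_index_iota//=.
  rewrite aJ eqxx scale1r big1 ?addr0 ?subrr ?rnorm0// => i ik.
  by rewrite aJ (inj_eq double_inj) (negPf ik) scale0r.
(* The backward orbit of the even index 2k. All its terms but the first are odd, so the coordinates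
   0 and 2 vanish along it after time 0. *)
pose idx k n := iter n (fun m => m.*2.+1) k.*2.
pose H k n := lam ^- n *: J (e (idx k n)).
have HB k n : rn (H k n) <= MJ * rn (e k.*2) * 4^-1 ^+ n.
  have Cn : rn (e (idx k n)) <= C ^+ n * rn (e k.*2).
    elim: n => [|n IH]; first by rewrite expr0 mul1r.
    by apply: (le_trans (eC _)); rewrite exprS -mulrA ler_wpM2l// ltW.
  have lamn : rn (lam ^- n) = (4 * C) ^- n.
    rewrite rnormV; congr (_^-1); elim: n {Cn} => [|n IH].
      by rewrite !expr0 rnorm1.
    by rewrite !exprS rnormM IH rnorm_emb gtr0_norm ?mulr_gt0.
  rewrite rnormZ lamn; apply: (@le_trans _ _ ((4 * C) ^- n * (MJ * (C ^+ n * rn (e k.*2))))).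
    have q : 0 <= (4 * C) ^- n by rewrite invr_ge0 exprn_ge0// mulr_ge0// ltW.
    rewrite ler_wpM2l//.
    by apply: (le_trans (hMJ _)); rewrite ler_wpM2l.
  rewrite le_eqVlt; apply/orP; left; apply/eqP; rewrite exprMn exprVn.
  by field; rewrite !expf_neq0// gt_eqF.
have HS k n : A (H k n.+1) = H k n.
  rewrite /H linearZ/= -/A0 -[A0 _]/(A _) A_odd scalerA exprS invfM mulrAC mulVf// mul1r//.
have H0 k : A (H k 0%N) = eta k by rewrite /H expr0 invr1 scale1r A_even.
have aH m k n : a m (H k n) = lam ^- n * (m == idx k n)%:R.
  transitivity (lam ^- n * a m (J (e (idx k n)))); last by rewrite aJ.
  exact: (linZ _ _ (lina m)).
have idx_odd k n : odd (idx k n.+1) by rewrite /= odd_double.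
have aHS m k n : ~~ odd m -> a m (H k n.+1) = 0.
  move=> om; rewrite aH; case: eqP => h; last by rewrite mulr0.
  by move: om; rewrite h idx_odd.
have Hchain k : (k < 2)%N -> chain A (a 0%N) (a 2%N) (H k).
  move=> k2; split; rewrite ?H0 /eta ?k2//.
  - by move=> n; rewrite aHS.
  - by move=> n; rewrite aHS.
  - by exists (MJ * rn (e k.*2)) => //; rewrite mulr_ge0// rnorm_ge0.
(* For k >= 2 the vector J e_{2k} is sent to [eta k], which lies in Y and is killed next; the chain
   therefore starts one step earlier. *)
pose G' k n := if n is n'.+1 then H k n' else eta k.
have G'chain k : (2 <= k)%N -> chain A (a 0%N) (a 2%N) (G' k).
  move=> k2; split => /=.
  - exact: A_U0.
  - by case.
  - move=> [|n]; last by rewrite /G' aHS.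
    by rewrite /G' aH; case: eqP => //=; rewrite ?mulr0//; rewrite /idx /=; lia.
  - move=> [|n]; last by rewrite /G' aHS.
    by rewrite /G' aH; case: eqP => //=; rewrite ?mulr0//; rewrite /idx /=; lia.
  - exists (rn (eta k) + 4 * (MJ * rn (e k.*2))).
      by rewrite addr_ge0 ?mulr_ge0// ?rnorm_ge0.
    have t : 0 <= 4 * (MJ * rn (e k.*2)) by rewrite !mulr_ge0// rnorm_ge0.
    move=> [|n] /=; first by rewrite expr0; lra.
    apply: (le_trans (HB _ _)); rewrite exprS mulrDl.
    have -> : 4 * (MJ * rn (e k.*2)) * (4^-1 * 4^-1 ^+ n) = MJ * rn (e k.*2) * 4^-1 ^+ n.
      by rewrite mulrCA !mulrA mulVf// mul1r.
    by rewrite lerDr mulr_ge0 ?rnorm_ge0// mulr_ge0// exprn_ge0.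
pose good := word_value A (a 0%N : Z -> K^o) (a 2%N : Z -> K^o).
have goodl b x z : good x -> good z -> good (b *: x + z).
  by apply: word_value_lin.
have good0 : good 0 by apply: (word_value_chain 0 linA _ _ (chain_cst0 linA _ _)).
have goodZ b x : good x -> good (b *: x) by move=> h; rewrite -[_ *: _]addr0; exact: goodl.
have goodH k n : good (H k n).
  have [k2|k2] := ltnP k 2; first exact: word_value_chain (Hchain k k2).
  exact: (word_value_chain n.+1 linA _ _ (G'chain k k2)).
have goodJ m : good (J (e m)).
  (* Halving m while it is odd strips the trailing ones of its binary expansion. *)
  have [k [n ->]] : exists k n, m = idx k n.
    elim/ltn_ind: m => m IH; have [om|om] := boolP (odd m).
      have [|k [n h]] := IH m./2; first lia.
      by exists k, n.+1; rewrite /idx iterS -/(idx k n) -h; lia.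
    by exists m./2, 0%N; rewrite /idx/=; lia.
  have -> : J (e (idx k n)) = lam ^+ n *: H k n.
    by rewrite /H scalerA divff ?scale1r// expf_neq0.
  exact: goodZ.
have goody k : good (y k).
  have h : good (eta k.+2) by exact: (word_value_chain 0 linA _ _ (G'chain k.+2 isT)).
  have -> : y k = emb s (eps k.+2)^-1 *: eta k.+2.
    by rewrite /eta/= scalerA -rmorphM mulVf ?rmorph1 ?scale1r// gt_eqF.
  exact: goodZ.
exists A, (a 0%N), (a 2%N), (H 0%N), (H 1%N); split.
- exists (emb s (`|4 * C| * (MJ * (MD * MU)) + 2)) => z.
  rewrite -!(emb_rnorm s) -rmorphM ler_emb /A/= /A0.
  apply: (le_trans (ler_rnormD _ _ _)); rewrite mulrDl lerD//; last by case: (hG z).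
  rewrite rnormZ rnorm_emb -!mulrA ler_wpM2l//.
  by apply: (le_trans (hMJ _)); rewrite ler_wpM2l//; apply: (le_trans (hMD _)); rewrite ler_wpM2l.
- split=> //; exists (Ca 0%N + Ca 2%N).
    by rewrite addr_ge0// ltW//; [case: (hCa 0%N) | case: (hCa 2%N)].
  move=> z; have [c0 h0] := hCa 0%N; have [c2 h2] := hCa 2%N; split.
    apply: (le_trans (h0 z)); rewrite ler_wpM2r ?rnorm_ge0//; lra.
  apply: (le_trans (h2 z)); rewrite ler_wpM2r ?rnorm_ge0//; lra.
- by split; rewrite ?aH /= ?expr0 ?invr1 ?mul1r//; exact: Hchain.
move=> z ep ep0.
have e2 : 0 < ep / 2 by rewrite divr_gt0.
have [k hk] := hz z _ e2.
have MJp : 0 < MJ + 1 by lra.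
have [N hN] := bcoordP s he (U (zeta k)) (divr_gt0 e2 MJp).
(* zeta k is the sum of its Y-part [y k] and of J (U (zeta k)); the latter is replaced by a partial
   sum of its expansion. *)
exists (y k + J (psum e (bcoord he (U (zeta k))) N)).
  have goodp n : good (J (psum e (bcoord he (U (zeta k))) n)).
    elim: n => [|n IH]; first by rewrite /psum big_geq// (lin0 linJ).
    by rewrite psumS addrC linJ; apply: goodl.
  by rewrite -[y k]scale1r; apply: goodl.
have := hN N (leqnn N); rewrite ltr_pdivlMr// => hN'.
set p := psum _ _ _ in hN' *.
have -> : z - (y k + J p) = (z - zeta k) + J (U (zeta k) - p).
  rewrite linearB /y opprD opprB [LHS]addrA [RHS]addrA; congr (_ - _).
  by rewrite addrCA addrC.
apply: (le_lt_trans (ler_rnormD _ _ _)); rewrite [ep]splitr ltrD//.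
apply: (le_lt_trans (hMJ _)); apply: le_lt_trans hN'.
by rewrite rdistC mulrC ler_wpM2l ?rnorm_ge0//; lra.
Qed.

End chains.

Lemma measurable_bigcup_countType d (T : measurableType d) (I : countType) (P : set I)
    (F : I -> set T) :
  (forall i, P i -> measurable (F i)) -> measurable (\bigcup_(i in P) F i).
Proof.
move=> mF; rewrite bigcup_mkcond; apply: countable_bigcupT_measurable.
  exact: countableP.
by move=> i; case: ifPn => //; rewrite inE => /mF.
Qed.

(** * Borel measurability in a separable Banach space *)

Section measurability.
Context {R : realType}.

Lemma measurable_fun_countable_glue d d' (X : measurableType d) (Y : measurableType d')
    (I : countType) (D : I -> set X) (fi : I -> X -> Y) (f : X -> Y) :
  (forall i, measurable (D i)) -> (forall x, exists i, D i x) ->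
  (forall i, measurable_fun setT (fi i)) ->
  (forall i x, D i x -> f x = fi i x) -> measurable_fun setT f.
Proof.
move=> mD cD mf ff _ B mB; rewrite setTI.
have -> : f @^-1` B = \bigcup_i (D i `&` fi i @^-1` B).
  apply/seteqP; split=> x /=.
    by move=> Bfx; have [i Di] := cD x; exists i => //; split => //; rewrite /= -ff.
  by move=> [i _ [/ff /= <-]].
apply: measurable_bigcup_countType => i _; apply: measurableI => //.
by rewrite -[X in measurable X]setTI; apply: mf.
Qed.

Context {K : numFieldType} (s : real_scalars R K).
Context {Z : completeNormedModType K}.
Local Notation rn := (rnorm s).

Lemma measurable_open_borel (U : set Z) : open U -> measurable (U : set (borel_space Z)).
Proof. by move=> oU; apply: sub_sigma_algebra. Qed.

Lemma lipschitz_measurable (f : Z -> R) (C : R) :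
  (forall x y, `|f x - f y| <= C * rn (x - y)) ->
  measurable_fun setT (f : borel_space Z -> R).
Proof.
move=> hf; have hf' x y : `|f x - f y| <= (`|C| + 1) * rn (x - y).
  apply: (le_trans (hf x y)); rewrite ler_wpM2r ?rnorm_ge0//.
  by have := ler_norm C; lra.
apply: (measurability _ (RGenOpens.measurableE R)) => _ [_ [a [b ->]] <-].
rewrite setTI; apply: measurable_open_borel; apply/(open_rball s) => x /=.
rewrite in_itv/= => /andP[ax xb].
have C1 : 0 < `|C| + 1 by rewrite ltr_wpDl.
exists (Num.min (f x - a) (b - f x) / (`|C| + 1)).
  by rewrite divr_gt0// lt_min !subr_gt0 ax.
move=> y; rewrite ltr_pdivlMr// mulrC => h.
have := le_lt_trans (hf' y x) h; rewrite lt_min => /andP[].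
rewrite !ltr_norml in_itv/=; lra.
Qed.

(** Balls of dyadic radius around a dense sequence form a countable base. *)
Lemma measurable_fun_borel_balls d (X : measurableType d) (f : X -> Z) : separable Z ->
  (forall z (r : R), 0 < r -> measurable [set x | rn (f x - z) < r]) ->
  measurable_fun setT (f : X -> borel_space Z).
Proof.
move=> /(separable_dense_sequence s)[zeta hz] hf.
apply: (@measurability _ _ _ (borel_space Z) setT f (@open Z : set (set (borel_space Z))) erefl).
move=> _ [U oU <-]; rewrite setTI.
pose rad n : R := 2^-1 ^+ n.
pose P (kn : nat * nat) := forall y, rn (y - zeta kn.1) < rad kn.2 -> U y.
have -> : f @^-1` U = \bigcup_(kn in P) [set x | rn (f x - zeta kn.1) < rad kn.2].
  apply/seteqP; split=> x /=; last by move=> [kn h1 /= h2]; exact: h1.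
  move=> Ufx; move/(open_rball s) : oU => /(_ _ Ufx)[r r0 hr].
  have [n hn] := half_pow_lt (divr_gt0 r0 (ltr0n _ 2)).
  have [k hk] := hz (f x) _ (half_pow_gt0 R n).
  exists (k, n) => // y /= hy; apply: hr.
  apply: (le_lt_trans (ler_rdistD s (zeta k) _ _)).
  have := hn _ (leqnn n); rewrite (rdistC s (zeta k)) /rad/= in hy *; lra.
by apply: measurable_bigcup_countType => kn _; apply: hf; exact: half_pow_gt0.
Qed.

Lemma real_avoiding_countable (f : nat -> R) : exists t : R, forall n, t != f n.
Proof.
apply: contrapT => h.
have : lebesgue_measure (range f) = 0%E.
  by apply: countable_lebesgue_measure0; exact: card_image_le.
have -> : range f = [set: R].
  apply/seteqP; split => // t _; apply: contrapT => ht; apply: h.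
  by exists t => n; apply/eqP => tn; apply: ht; exists n.
move=> h0.
have : (lebesgue_measure (`[0%R, 1%R]%classic : set R) <= 0)%E.
  by rewrite -h0; apply: le_measure => //; rewrite ?inE.
by rewrite lebesgue_measure_itv/= lte_fin ltr01 sube0 lee_fin ler10.
Qed.

End measurability.

(** The 2-adic valuation gives the first entry, the odd part the second. This code is preferred for
    being at least 2^j on the letters of word j. *)
Lemma two_adic_code_inj : injective (fun l : nat * nat => (2 ^ l.1 * l.2.*2.+1)%N).
Proof.
have lg (l : nat * nat) : logn 2 (2 ^ l.1 * l.2.*2.+1) = l.1.
  by rewrite lognM// ?expn_gt0// pfactorK// lognE/= dvdn2/= odd_double/= addn0.
move=> [j n] [j' n'] h; have := congr1 (logn 2) h; rewrite !lg /= => jj.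
subst j'; move/eqP: h; rewrite /= eqn_pmul2l ?expn_gt0// => /eqP [].
by move/double_inj ->.
Qed.

(** * Letters *)

Section letters.
Context {R : realType} {K : numFieldType} (s : real_scalars R K).
Context {Z : completeNormedModType K}.
Local Notation rn := (rnorm s).

(* The letters are pairs (j, n), the n-th letter of the j-th word; c (j, n) p is a chain coding the
   real p, and g recovers p 0 from the sum \sum_m c (l m) (p m) m.  The value of l0 at that sum is
   that of the first letter, made injective on letters by the parameter tau; l1 then gives p. *)
Lemma operator_with_letters : separable Z -> complemented_subsymmetric Z ->
  exists (A : {linear Z -> Z}) (c : nat * nat -> R -> nat -> Z) (N : nat -> nat)
    (g : borel_space Z -> R),
  [/\ bounded_operator A,
      [/\ forall j, (j < N j)%N, forall i j, (i <= j)%N -> (N i <= N j)%N &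
      forall l p, A (c l p 0%N) = 0 /\ forall m, A (c l p m.+1) = c l p m],
      (forall l p m, 0 <= p <= 1 -> rn (c l p m) <= 2 ^+ N l.1 * 4^-1 ^+ m) /\
      (forall l p p' m, rn (c l p m - c l p' m) <= `|p - p'| * (2 ^+ N l.1 * 4^-1 ^+ m)),
      (forall U : set Z, open U -> U !=set0 -> exists2 r : R, 0 < r &
         forall j0, exists2 j, (j0 <= j)%N & forall p : nat -> R,
           (forall n, 0 <= p n <= 1) -> forall z,
           rn (\sum_(0 <= n < N j) c (j, n) (p n) n - z) < r -> U z) &
      measurable_fun setT g /\
      forall (l : nat -> nat * nat) p z,
        tends s (fun n => \sum_(0 <= m < n) c (l m) (p m) m) z -> g z = p 0%N].
Proof.
move=> sepZ csZ.
have [A [l0 [l1 [h0 [h1 [bA [lin0 lin1 [C C0 hC]] [ch0 ch1 [l0h0 l1h0] [l0h1 l1h1]] dens]]]]]] :=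
  operator_with_chains s sepZ csZ.
have linA : lin A by move=> a x y; rewrite linearP.
have [zeta hz] := separable_dense_sequence s sepZ.
(* The valuation [logn 2 j] takes each value for arbitrarily large j, so each zeta_k is approximated
   by infinitely many words, ever more closely. *)
have [len [v hv]] : exists (len : nat -> nat) (v : nat -> nat -> nat -> Z), forall j,
    chain_word s A l0 l1 (len j) (v j) /\
    rn (zeta (logn 2 j) - \sum_(0 <= i < len j) v j i i) < 2^-1 ^+ j.
  suff : forall j, exists u : nat * (nat -> nat -> Z), chain_word s A l0 l1 u.1 u.2 /\
      rn (zeta (logn 2 j) - \sum_(0 <= i < u.1) u.2 i i) < 2^-1 ^+ j.
    by move=> /choice[f hf]; exists (fun j => (f j).1), (fun j => (f j).2).
  move=> j; have [w [N [cs [hcs ->]]] hw] := dens (zeta (logn 2 j)) _ (half_pow_gt0 R j).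
  by exists (N, cs).
have [B0 B00 hB0] := chain_bound ch0.
have [B1 B10 hB1] := chain_bound ch1.
have [V hV] : exists V : nat -> R, forall j, 0 <= V j /\
    forall i m, rn (v j i m) <= V j * 4^-1 ^+ m.
  suff : forall j, exists V : R, 0 <= V /\ forall i m, rn (v j i m) <= V * 4^-1 ^+ m.
    by move=> /choice[f hf]; exists f.
  move=> j; have [[hc hc0] _] := hv j.
  suff [W [W0 hW]] : exists W : R, 0 <= W /\
      forall i m, (i < len j)%N -> rn (v j i m) <= W * 4^-1 ^+ m.
    exists W; split => // i m; have [ij|ij] := ltnP i (len j); first exact: hW.
    by rewrite hc0// rnorm0 mulr_ge0// exprn_ge0.
  elim: (len j) => [|n [W [W0 hW]]]; first by exists 0.
  have [M M0 hM] := chain_bound (hc n).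
  exists (W + M); split; first exact: addr_ge0.
  move=> i m; have q : 0 <= (4^-1 : R) ^+ m by rewrite exprn_ge0.
  rewrite ltnS leq_eqVlt mulrDl => /orP[/eqP -> |/hW h].
    by apply: (le_trans (hM m)); rewrite lerDr mulr_ge0.
  by apply: (le_trans (h m)); rewrite lerDl mulr_ge0.
pose code (l : nat * nat) := (2 ^ l.1 * l.2.*2.+1)%N.
(* Size of the perturbation of a letter: injective, which makes [tau] possible, and at most 2^-j on
   word j, which keeps the value of the word close to its target. *)
pose del (l : nat * nat) : R := (code l)%:R^-1.
have code0 l : 0 < (code l)%:R :> R by rewrite ltr0n muln_gt0 expn_gt0.
have del0 l : 0 < del l by rewrite invr_gt0.
have dell l : del l <= 2^-1 ^+ l.1.
  rewrite /del exprVn lef_pV2 ?posrE ?exprn_gt0// -natrX ler_nat.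
  by rewrite leq_pmulr.
have del1 l : del l <= 1 by apply: (le_trans (dell l)); rewrite exprn_ile1//; lra.
have del_inj : injective del.
  move=> l l' /invr_inj /eqP; rewrite eqr_nat => /eqP; exact: two_adic_code_inj.
pose alpha (l : nat * nat) : K := l0 (v l.1 l.2 0%N).
(* Each pair of distinct letters excludes at most one real value of [tau], as their factors [del]
   differ; only countably many values are excluded. *)
have [tau htau] : exists tau : R, forall l l', l != l' ->
    alpha l + emb s (del l * tau) != alpha l' + emb s (del l' * tau).
  pose f n : R := if (unpickle n : option ((nat * nat) * (nat * nat))) is Some (l, l') then
     re s (alpha l' - alpha l) / (del l - del l') else 0.
  have [tau ht] := real_avoiding_countable f.
  exists tau => l l' ll'; apply/eqP => e.
  have := ht (pickle (l, l')); rewrite /f pickleK => /eqP; apply.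
  have -> : alpha l' - alpha l = emb s ((del l - del l') * tau).
    by rewrite mulrBl rmorphB; apply/eqP; rewrite subr_eq addrAC eq_sym subr_eq addrC e.
  rewrite re_emb mulrAC divff ?mul1r// subr_eq0.
  by apply: contra_neq ll'; exact: del_inj.
pose c (l : nat * nat) (p : R) (m : nat) : Z :=
  v l.1 l.2 m + (emb s (del l * tau) *: h0 m + emb s (del l * p) *: h1 m).
have cch l p : chain s A l0 l1 (c l p).
  have [[hc _] _] := hv l.1.
  have := chain_lin 1 linA lin0 lin1 (hc l.2)
    (chain_lin (emb s (del l * tau)) linA lin0 lin1 ch0
    (chain_lin (emb s (del l * p)) linA lin0 lin1 ch1 (chain_cst0 s linA lin0 lin1))).
  congr chain; apply/funext => m; by rewrite /c scale1r addr0.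
pose err l p m := emb s (del l * tau) *: h0 m + emb s (del l * p) *: h1 m.
pose W := `|tau| * B0 + B1.
have W0 : 0 <= W by rewrite addr_ge0// mulr_ge0.
have errB l p m : 0 <= p <= 1 -> rn (err l p m) <= del l * W * 4^-1 ^+ m.
  move=> /andP[p0 p1]; have q : 0 <= (4^-1 : R) ^+ m by rewrite exprn_ge0.
  apply: (le_trans (ler_rnormD _ _ _)).
  rewrite !rnormZ !rnorm_emb !normrM !(gtr0_norm (del0 l)) (ger0_norm p0) /W.
  rewrite mulrDr mulrDl lerD//.
    by rewrite -!mulrA ler_pM2l// ler_wpM2l.
  rewrite -!mulrA ler_pM2l//; apply: le_trans (hB1 m).
  by rewrite ler_piMl// rnorm_ge0.
(* Words are padded to a length N j exceeding [bd j], so that 2^(N j) dominates every constant in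
   the bounds of their letters, by n < 2^n. *)
pose bd j := Num.bound (V j + W + B1).
pose N j := (\sum_(0 <= i < j.+1) (len i + bd i + 1))%N.
have NS j : N j.+1 = (N j + (len j.+1 + bd j.+1 + 1))%N by rewrite /N big_nat_recr.
have Ngt j : (len j + bd j + j < N j)%N.
  elim: j => [|j IH]; first by rewrite /N big_nat1; lia.
  by rewrite NS; lia.
have Nmono i j : (i <= j)%N -> (N i <= N j)%N.
  move=> ij; rewrite -(subnK ij); elim: (j - i)%N => [|d IH]//.
  by rewrite addSn NS; lia.
have NB j : V j + W + B1 <= 2 ^+ N j.
  have [Vj _] := hV j; have VW : 0 <= V j + W + B1 by lra.
  apply: (le_trans (ltW (archi_boundP VW))); rewrite -natrX ler_nat.
  apply: (@leq_trans (N j)); last exact: ltnW (ltn_expl _ _).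
  by have := Ngt j; rewrite /bd; lia.
pose isl (l : nat * nat) (z : Z) := l0 z = alpha l + emb s (del l * tau).
pose gl (l : nat * nat) (z : Z) := re s (l1 z - l1 (v l.1 l.2 0%N)) / del l.
pose g (z : Z) : R := if pselect (exists l, isl l z) is left h then gl (sval (cid h)) z else 0.
have isl_uniq l l' z : isl l z -> isl l' z -> l = l'.
  move=> h1' h2'; apply/eqP; apply: contraPT isT => /htau.
  by rewrite -h1' -h2' eqxx.
have gE l z : isl l z -> g z = gl l z.
  move=> h; rewrite /g; case: pselect => [h'|[]]; last by exists l.
  by rewrite (isl_uniq _ _ _ (svalP (cid h')) h).
have lB (f : Z -> K^o) z y : lin f -> rn (f z - f y : K) = rn (f (z - y) : K).
  by move=> lf; rewrite (linB _ _ lf).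
exists A, c, N, g; split => //.
- split=> //; first by move=> j; have := Ngt j; lia.
  by move=> l p; case: (cch l p).
- split.
    move=> l p m p01; have q : 0 <= (4^-1 : R) ^+ m by rewrite exprn_ge0.
    apply: (le_trans (ler_rnormD _ _ _)).
    apply: (@le_trans _ _ ((V l.1 + W) * 4^-1 ^+ m)); last first.
      by rewrite ler_wpM2r//; apply: le_trans (NB l.1); lra.
    rewrite mulrDl lerD//; first by case: (hV l.1).
    apply: (le_trans (errB l p m p01)); rewrite ler_wpM2r// ler_piMl//.
  move=> l p p' m; have q : 0 <= (4^-1 : R) ^+ m by rewrite exprn_ge0.
  have -> : c l p m - c l p' m = emb s (del l * (p - p')) *: h1 m.
    by rewrite /c opprD addrACA subrr add0r opprD addrACA subrr add0r -scalerBl -rmorphB -mulrBr.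
  rewrite rnormZ rnorm_emb normrM (gtr0_norm (del0 l)) -mulrA.
  apply: (@le_trans _ _ (`|p - p'| * rn (h1 m))).
    by rewrite ler_piMl// mulr_ge0 ?rnorm_ge0.
  rewrite ler_wpM2l//; apply: (le_trans (hB1 m)); rewrite ler_wpM2r//.
  by apply: le_trans (NB l.1); have [] := hV l.1; lra.
- move=> U oU [z0 Uz0].
  have [r r0 hr] : exists2 r : R, 0 < r & forall y, rn (y - z0) < r -> U y.
    by move/(open_rball s) : oU => /(_ _ Uz0).
  exists (r / 2); first by rewrite divr_gt0.
  move=> j0.
  have [k hk] := hz z0 _ (divr_gt0 r0 (ltr0n _ 8)).
  have t0 : 0 < r / (8 * (1 + 2 * W)) by rewrite divr_gt0// mulr_gt0//; lra.
  have [n0 hn0] := half_pow_lt t0.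
  (* An index of valuation k that is at least [j0] and [n0]. *)
  pose b := maxn j0 n0; pose j := (2 ^ k * b.*2.+1)%N.
  have jb : (b <= j)%N.
    by apply: (@leq_trans b.*2.+1); [lia | rewrite leq_pmull// expn_gt0].
  have lj : logn 2 j = k.
    by rewrite /j lognM// ?expn_gt0// pfactorK// lognE/= dvdn2/= odd_double/= addn0.
  exists j; first exact: leq_trans (leq_maxl _ _) jb.
  move=> p p01 z hzz; apply: hr.
  have [[hc hc0] hj] := hv j; rewrite lj in hj.
  have sj := hn0 j (leq_trans (leq_maxr _ _) jb).
  have e1 : \sum_(0 <= n < N j) v j n n = \sum_(0 <= i < len j) v j i i.
    have lN : (len j <= N j)%N by apply: leq_trans (ltnW (Ngt j)); rewrite -addnA leq_addr.
    rewrite (big_cat_nat (leq0n _) lN)/= [X in _ + X]big_nat.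
    by rewrite [X in _ + X]big1 ?addr0// => i /andP[h _]; rewrite hc0.
  have e2 : \sum_(0 <= n < N j) c (j, n) (p n) n =
      \sum_(0 <= i < len j) v j i i + \sum_(0 <= n < N j) err (j, n) (p n) n.
    by rewrite -e1 -big_split.
  have e3 : rn (\sum_(0 <= n < N j) err (j, n) (p n) n) <= 2^-1 ^+ j * (2 * W).
    apply: (le_trans (ler_rnorm_sum _ _ _ _)).
    apply: (@le_trans _ _ (\sum_(0 <= n < N j) 2^-1 ^+ j * W * 2^-1 ^+ n)).
      apply: ler_sum => n _; apply: (le_trans (errB _ _ _ (p01 n))).
      have w2 : (4^-1 : R) ^+ n <= 2^-1 ^+ n by apply: lerXn2r; rewrite ?nnegrE; lra.
      apply: ler_pM => //; rewrite ?mulr_ge0 ?exprn_ge0//; first exact: ltW.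
      by rewrite ler_wpM2r//; exact: (dell (j, n)).
    rewrite -mulr_sumr; have := sum_half_pow_le R 0 (N j); rewrite expr0 mulr1 => h.
    rewrite -mulrA ler_wpM2l ?exprn_ge0// mulrC ler_wpM2r//.
  rewrite e2 in hzz; set w := \sum_(0 <= i < len j) _ in hzz hj *.
  set er := \sum_(0 <= n < N j) _ in hzz e3 *.
  have h4 := ler_rdistD s (w + er) z z0.
  have h5 := ler_rdistD s w (w + er) z0.
  have h6 := ler_rdistD s (zeta k) w z0.
  rewrite (rdistC s (w + er) z) in hzz *.
  rewrite (rdistC s w (zeta k)) in h6; rewrite (rdistC s (zeta k) z0) in h6.
  rewrite (addrAC w er (- w)) subrr add0r in h5.
  have h7 : 2^-1 ^+ j * (1 + 2 * W) < r / 8.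
    move: sj; rewrite invfM mulrA ltr_pdivlMr//; lra.
  have h8 : 2^-1 ^+ j * (1 + 2 * W) = 2^-1 ^+ j + 2^-1 ^+ j * (2 * W) by rewrite mulrDr mulr1.
  lra.
split.
  pose D (o : option (nat * nat)) : set (borel_space Z) :=
    if o is Some l then [set z | isl l z] else [set z | ~ exists l, isl l z].
  have mi l : measurable ([set z | isl l z] : set (borel_space Z)).
    have -> : [set z | isl l z] = [set z | rn ((l0 z : K) - (alpha l + emb s (del l * tau))) = 0].
      apply/seteqP; split=> z /= h; first by rewrite h subrr rnorm0.
      by apply/eqP; rewrite -subr_eq0 -(rnorm_eq0 s) h.
    have mf : measurable_fun setT
       ((fun z => rn ((l0 z : K) - (alpha l + emb s (del l * tau)))) : borel_space Z -> R).
      apply: (@lipschitz_measurable _ _ s _ _ C) => x y.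
      have hxy := (hC (x - y)).1.
      rewrite -lB// in hxy; apply: le_trans hxy.
      have := ler_rdistD s (l0 x : K) (l0 y : K) (alpha l + emb s (del l * tau)).
      have := ler_rdistD s (l0 y : K) (l0 x : K) (alpha l + emb s (del l * tau)).
      rewrite (rdistC s (l0 y : K) (l0 x : K)) ler_norml; lra.
    rewrite -[X in measurable X]setTI; exact: (mf measurableT _ (measurable_set1 (0 : R))).
  apply: (@measurable_fun_countable_glue _ _ _ _ _ D
    (fun o => if o is Some l then gl l else cst 0)).
  - move=> [l|]; first exact: mi.
    have -> : D None = ~` \bigcup_l [set z | isl l z].
      apply/seteqP; split=> z /= h [l]; first by move=> _ hl; apply: h; exists l.
      by move=> hl; apply: h; exists l.
    by apply: measurableC; apply: measurable_bigcup_countType => l _; exact: mi.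
  - move=> z; have [[l hl]|h] := pselect (exists l, isl l z); [by exists (Some l) | by exists None].
  - move=> [l|]; last exact: measurable_cst.
    apply: (@lipschitz_measurable _ _ s _ _ (C / del l)) => x y.
    rewrite /gl -mulrBl -raddfB opprB addrA subrK normrM normfV (gtr0_norm (del0 l)).
    have dV : 0 <= (del l)^-1 by rewrite invr_ge0 ltW.
    rewrite mulrAC ler_wpM2r//.
    apply: (le_trans (re_le_norm _ _)); have := (hC (x - y)).2.
    by rewrite -lB.
  - move=> [l|] z /=; first exact: gE.
    by move=> h; rewrite /g; case: pselect.
move=> l p z hzz.
(* A continuous functional that vanishes on all terms after the first sees only the first. *)
have lim (f : Z -> K^o) : lin f -> (forall z, rn (f z : K) <= C * rn z) ->
    (forall m, f (c (l m.+1) (p m.+1) m.+1) = 0) -> f z = f (c (l 0%N) (p 0%N) 0%N).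
  move=> lf fB f0.
  have fs n : f (\sum_(0 <= m < n.+1) c (l m) (p m) m) = f (c (l 0%N) (p 0%N) 0%N).
    elim: n => [|n IH]; first by rewrite big_nat1.
    by rewrite big_nat_recr//= (linD _ _ lf) IH f0 addr0.
  apply: (tends_uniq (s := s) (u := fun n => f (\sum_(0 <= m < n.+1) c (l m) (p m) m) : K)).
    move=> ep ep0; have C1 : 0 < C + 1 by lra.
    have [n0 hn0] := hzz _ (divr_gt0 ep0 C1); exists n0 => n nn.
    have := hn0 n.+1 (leqW nn); rewrite ltr_pdivlMr// lB//; apply: le_lt_trans.
    apply: (le_trans (fB _)); rewrite mulrC ler_wpM2l ?rnorm_ge0//; lra.
  by apply: tends_ext (tends_cst s _) => n; rewrite fs.
have i0 : isl (l 0%N) z.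
  rewrite /isl (lim l0)//; last by move=> m; have [] := cch (l m.+1) (p m.+1).
    rewrite /c !(linD _ _ lin0) !(linZ _ _ lin0) l0h0 l0h1 scaler0 addr0.
    by congr (_ + _); exact: mulr1.
  by move=> x; case: (hC x).
rewrite (gE _ _ i0) /gl (lim l1)//; last 2 first.
- by move=> x; case: (hC x).
- by move=> m; have [] := cch (l m.+1) (p m.+1).
rewrite /c !(linD _ _ lin1) !(linZ _ _ lin1) l1h0 l1h1 scaler0 add0r.
rewrite addrAC subrr add0r (_ : _ *: 1 = emb s (del (l 0%N) * p 0%N)); last exact: mulr1.
by rewrite re_emb mulrAC divff ?mul1r// gt_eqF.
Qed.

End letters.

(** * Words read along ergodic orbits *)

Section prob.
Context d (X : measurableType d) (R : realType) (P : probability X R).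
Implicit Types A B : set X.

Definition pr A : R := fine (P A).

Lemma prE A : measurable A -> P A = (pr A)%:E.
Proof. by move=> mA; rewrite fineK// fin_num_measure. Qed.

Lemma pr_ge0 A : 0 <= pr A.
Proof. by rewrite fine_ge0. Qed.

Lemma pr_le A B : measurable A -> measurable B -> A `<=` B -> pr A <= pr B.
Proof. by move=> mA mB AB; rewrite -lee_fin -!prE// le_measure// inE. Qed.

Lemma pr_leU A B : measurable A -> measurable B -> pr (A `|` B) <= pr A + pr B.
Proof.
move=> mA mB; rewrite -lee_fin EFinD -!prE ?measureU2//; exact: measurableU.
Qed.

Lemma pr_bigU n (F : nat -> set X) (b : R) : (forall i, measurable (F i)) ->
  (forall i, pr (F i) <= b) -> pr (\big[setU/set0]_(i < n) F i) <= n%:R * b.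
Proof.
move=> mF Fb; elim: n => [|n IH]; first by rewrite big_ord0 mul0r /pr measure0.
have mb : measurable (\big[setU/set0]_(i < n) F i) by apply: bigsetU_measurable.
rewrite big_ord_recr/=; apply: (le_trans (pr_leU mb (mF n))).
by rewrite -natr1 mulrDl mul1r lerD.
Qed.

Lemma pr_bigcup_half (F : nat -> set X) (b : R) : (forall i, measurable (F i)) ->
  (forall i, pr (F i) <= b * 2^-1 ^+ i) -> pr (\bigcup_i F i) <= 2 * b.
Proof.
move=> mF Fb; have mU : measurable (\bigcup_i F i) by exact: bigcupT_measurable.
have b0 : 0 <= b by have := Fb 0%N; rewrite expr0 mulr1; apply: le_trans; exact: pr_ge0.
rewrite -lee_fin -prE//; apply: (le_trans (generalized_Boole_inequality P mF mU)).
apply: lime_le; first exact: is_cvg_nneseries.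
apply: nearW => n; rewrite (eq_bigr (fun i => (pr (F i))%:E)); last by move=> i _; exact: prE.
rewrite sumEFin lee_fin; apply: (@le_trans _ _ (\sum_(0 <= i < n) b * 2^-1 ^+ i)).
  exact: ler_sum.
have := sum_half_pow_le R 0 n; rewrite expr0 mulr1 -mulr_sumr mulrC => h.
by rewrite ler_wpM2r.
Qed.

Lemma pr_gt0_setD A B : measurable A -> measurable B -> pr B < pr A -> 0 < pr (A `\` B).
Proof.
move=> mA mB BA; have mD := measurableD mA mB.
have := pr_leU mD mB.
have : pr A <= pr (A `\` B `|` B).
  apply: pr_le => //; first exact: measurableU.
  by move=> x Ax; have [Bx|nBx] := pselect (B x); [right|left].
move: BA; lra.
Qed.

End prob.

Section ergodic.
Context d (X : measurableType d) (R : realType) (P : probability X R) (S : X -> X).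
Hypothesis mS : measurable_fun setT S.
Hypothesis pS : forall A, measurable A -> P (S @^-1` A) = P A.
Hypothesis erg : forall A, measurable A -> P (A `\` S @^-1` A) = 0%E -> P A = 0%E \/ P A = 1%E.
Hypothesis small : forall e : R, 0 < e -> exists2 C, measurable C & (0 < P C < e%:E)%E.
Local Notation pr := (pr P).

Lemma measurable_preimS A : measurable A -> measurable (S @^-1` A).
Proof. by move=> mA; rewrite -[X in measurable X]setTI; exact: mS. Qed.

Lemma measurable_iter n A : measurable A -> measurable (iter n S @^-1` A).
Proof.
elim: n A => [|n IH] A mA //.
exact: (IH (S @^-1` A) (measurable_preimS mA)).
Qed.

Lemma pr_iter n A : measurable A -> pr (iter n S @^-1` A) = pr A.
Proof.
elim: n A => [|n IH] A mA //.
by rewrite (IH (S @^-1` A) (measurable_preimS mA)) /pr/= pS.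
Qed.

(* The points of a small set C that do not return to C before time N form the base of a tower of
   height N; were they negligible, the points visiting C before time N would form an invariant
   set of intermediate measure. *)
Lemma tower_base (N : nat) (e : R) : (0 < N)%N -> 0 < e ->
  exists B, [/\ measurable B, 0 < pr B < e &
    forall t i j, (i < N)%N -> (j < N)%N -> B (iter i S t) -> B (iter j S t) -> i = j].
Proof.
move=> N0 e0.
have h0 : 0 < Num.min e (N%:R^-1) by rewrite lt_min e0 invr_gt0 ltr0n.
(* Measure below 1/N prevents the N preimages of [C] that form [V] from having full measure. *)
have [C mC] := small h0; rewrite (prE P mC) !lte_fin lt_min => /andP[C0 /andP[Ce CN]].
pose F i := iter i S @^-1` C.
have mF i : measurable (F i) by exact: measurable_iter.
pose B := C `\` \bigcup_(i in [set i | (0 < i < N)%N]) F i.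
have mB : measurable B.
  by apply: measurableD => //; apply: bigcup_measurable.
exists B; split => //.
- have -> : pr B < e.
    by apply: le_lt_trans Ce; apply: pr_le => // x [].
  rewrite andbT lt_neqAle pr_ge0 andbT eq_sym; apply/negP => /eqP B0.
  pose V := \big[setU/set0]_(i < N) F i.
  have mV : measurable V by apply: bigsetU_measurable.
  have VC : C `<=` V.
    by move=> x Cx; rewrite /V -bigcup_mkord; exists 0%N.
  have V1 : pr V < 1.
    apply: (@le_lt_trans _ _ (N%:R * pr C)).
      by apply: pr_bigU => // i; rewrite pr_iter.
    by rewrite mulrC -ltr_pdivlMr ?ltr0n// mul1r.
  (* A point of [V] whose image leaves [V] does not visit [C] at times 1, ..., N; its visit must be
     at time 0, so it lies in [B]. *)
  have VS : V `\` S @^-1` V `<=` B.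
    move=> x [] /=; rewrite /V -bigcup_mkord => -[i iN Fi] nV.
    have h k : (0 < k <= N)%N -> ~ F k x.
      case: k => // k /andP[_ kN] Fk; apply: nV; exists k => //.
      by rewrite /F /= -iterSr.
    have i0 : i = 0%N.
      by apply/eqP; rewrite -leqn0 leqNgt; apply/negP => i0; apply: (h i) Fi; rewrite i0/= ltnW.
    split; first by move: Fi; rewrite i0.
    by move=> [k /andP[k0 kN]]; apply: h; rewrite k0/= ltnW.
  have VS0 : P (V `\` S @^-1` V) = 0%E.
    have mD : measurable (V `\` S @^-1` V) by apply: measurableD => //; exact: measurable_preimS.
    rewrite prE//; congr EFin; apply/eqP; rewrite eq_le pr_ge0 andbT -B0.
    exact: pr_le.
  have := pr_le P mC mV VC.
  by case: (erg mV VS0); rewrite prE// => -[]; move: V1 C0; lra.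
move=> t.
suff h i j : (i < j < N)%N -> B (iter i S t) -> B (iter j S t) -> False.
  move=> i j iN jN Bi Bj; apply/eqP; apply/negPn/negP; rewrite neq_ltn => /orP[ij|ji].
    by apply: (h i j) => //; rewrite ij.
  by apply: (h j i) => //; rewrite ji.
move=> /andP[ij jN] [_ h] [Cj _]; apply: h; exists (j - i)%N => /=.
  by rewrite subn_gt0 ij; lia.
by rewrite /F/= -iterD subnK// ltnW.
Qed.

Context (N : nat -> nat).
Hypothesis N_gt : forall j, (j < N j)%N.
Hypothesis N_mono : forall i j, (i <= j)%N -> (N i <= N j)%N.

(* The word i is read along the tower over B i of height N i, overwritten by the later towers; r
   makes the bases decrease so fast that, with probability close to 1 even relative to B i, no base
   B j with j > i is visited before time 2 N j.  The letters seen at times m >= N i then belong to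
   words j with N j <= m. *)
Lemma ergodic_words : exists kappa : X -> nat * nat,
  [/\ forall l, measurable (kappa @^-1` [set l]),
      exists2 G, measurable G /\ P (~` G) = 0%E &
        forall t, G t -> exists m0, forall m, (m0 <= m)%N -> (N (kappa (iter m S t)).1 <= m)%N &
      forall i, exists2 E, measurable E /\ (0 < P E)%E &
        forall t, E t -> (forall n, (n < N i)%N -> kappa (iter n S t) = (i, n)) /\
          forall m, (N i <= m)%N -> (N (kappa (iter m S t)).1 <= m)%N].
Proof.
have N0 j : (0 < N j)%N by apply: leq_ltn_trans (N_gt j).
have N0R j : 0 < (N j)%:R :> R by rewrite ltr0n.
have [Bf hBf] : exists Bf : nat * R -> set X, forall u, (0 < u.1)%N -> 0 < u.2 ->
   [/\ measurable (Bf u), 0 < pr (Bf u) < u.2 &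
    forall t i j, (i < u.1)%N -> (j < u.1)%N -> Bf u (iter i S t) -> Bf u (iter j S t) -> i = j].
  suff : forall u : nat * R, exists B, (0 < u.1)%N -> 0 < u.2 ->
    [/\ measurable B, 0 < pr B < u.2 &
      forall t i j, (i < u.1)%N -> (j < u.1)%N -> B (iter i S t) -> B (iter j S t) -> i = j].
    by move=> /choice[f hf]; exists f.
  move=> [n e] /=; have [n0|n0] := ltnP 0 n; last by exists setT.
  have [e0|e0] := ltP 0 e; last by exists setT.
  by have [B hB] := tower_base n0 e0; exists B.
(* Twice N j preimages of a set of this measure have total measure r 2^-j / 4. *)
pose del j (r : R) := r * 2^-1 ^+ j / (8 * (N j)%:R).
(* r (i+1) is at most the measure of base i, so all later bases are small relative to every earlier
   one. *)
pose r := fix r j : R := if j is i.+1 then Num.min (r i) (pr (Bf (N i, del i (r i)))) else 1.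
pose B j := Bf (N j, del j (r j)).
have del0 j (x : R) : 0 < x -> 0 < del j x.
  by move=> x0; rewrite divr_gt0// mulr_gt0// half_pow_gt0.
have rS j : r j.+1 = Num.min (r j) (pr (B j)) by [].
have r0 j : 0 < r j.
  elim: j => [|j IH] //; rewrite rS lt_min IH/=.
  by have [_ /andP[]] := hBf (N j, del j (r j)) (N0 j) (del0 _ _ IH).
have [mB Bgt0 Blt Bdisj] : [/\ forall j, measurable (B j), forall j, 0 < pr (B j),
    forall j, pr (B j) < del j (r j) &
    forall j t i i', (i < N j)%N -> (i' < N j)%N ->
      B j (iter i S t) -> B j (iter i' S t) -> i = i'].
  by split=> j; have [? /andP[? ?] ?] := hBf (N j, del j (r j)) (N0 j) (del0 _ _ (r0 j)).
have rmono i j : (i <= j)%N -> r j <= r i.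
  move=> ij; rewrite -(subnK ij); elim: (j - i)%N => [|k IH]//.
  by rewrite addSn rS; apply: le_trans IH; rewrite ge_min lexx.
have r1 j : r j <= 1 by apply: (rmono 0%N).
(* A letter of word j seen at a time m < N j announces a visit to B j within fewer than N j further
   steps, hence before time 2 N j. *)
pose D j := \big[setU/set0]_(i < (N j).*2) (iter i S @^-1` B j).
have mD j : measurable (D j).
  by apply: bigsetU_measurable => i _; exact: measurable_iter.
have inD j t : D j t <-> exists2 i, (i < (N j).*2)%N & B j (iter i S t).
  have -> : D j = \bigcup_(i in `I_(N j).*2) (iter i S @^-1` B j) by rewrite bigcup_mkord.
  by split => -[i ? ?]; exists i.
have prD j : pr (D j) <= r j * 2^-1 ^+ j / 4.
  apply: (@le_trans _ _ ((N j).*2%:R * pr (B j))).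
    apply: (@pr_bigU _ _ _ P _ (fun i => iter i S @^-1` B j)) => i.
      exact: measurable_iter.
    by rewrite pr_iter.
  have -> : r j * 2^-1 ^+ j / 4 = (N j).*2%:R * del j (r j).
    rewrite /del -mul2n natrM; field; rewrite pnatr_eq0 -lt0n//.
  by rewrite ler_wpM2l// ltW.
pose T i := \bigcup_k D (i.+1 + k)%N.
have mT i : measurable (T i) by exact: bigcupT_measurable.
have prT i : pr (T i) <= r i.+1 * 2^-1 ^+ i / 4.
  apply: (@le_trans _ _ (2 * (r i.+1 * 2^-1 ^+ i.+1 / 4))); last first.
    by rewrite exprS; lra.
  apply: pr_bigcup_half => // k; apply: (le_trans (prD _)).
  rewrite exprD; have h1 := half_pow_gt0 R i.+1; have h2 := half_pow_gt0 R k.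
  have rm : r (i.+1 + k)%N <= r i.+1 by apply: rmono; lia.
  have uw : 0 <= (2^-1 : R) ^+ i.+1 * 2^-1 ^+ k by rewrite mulr_ge0// ltW.
  have := ler_wpM2r uw rm; lra.
(* Letter n of word j is read N j - 1 - n steps before a visit to B j, unless a longer-indexed word
   is being read. By the tower property at most one n fits. *)
pose L (l : nat * nat) : set X :=
  [set t | (l.2 < N l.1)%N /\ B l.1 (iter (N l.1 - l.2.+1)%N S t) /\
     forall j i, (l.1 < j)%N -> (i < N j)%N -> ~ B j (iter i S t)].
have mL l : measurable (L l).
  have [lN|lN] := boolP (l.2 < N l.1)%N; last first.
    by rewrite (_ : L l = set0)//; apply/seteqP; split=> t // -[]; rewrite (negPf lN).
  have -> : L l = (iter (N l.1 - l.2.+1) S @^-1` B l.1) `\`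
     \bigcup_(u in [set u : nat * nat | (l.1 < u.1)%N /\ (u.2 < N u.1)%N])
        (iter u.2 S @^-1` B u.1).
    apply/seteqP; split => t.
      by move=> [_ [h1 h2]]; split => // -[[j i] [/= h3 h4]]; exact: h2.
    move=> [h1 h2]; split => //; split => // j i ij iN h3.
    by apply: h2; exists (j, i).
  apply: measurableD; first exact: measurable_iter.
  by apply: measurable_bigcup_countType => u _; exact: measurable_iter.
have L_uniq l l' t : L l t -> L l' t -> l = l'.
  move=> [l1 [l2 l3]] [k1 [k2 k3]].
  have [h|h|h] := ltngtP l.1 l'.1.
  - by exfalso; apply: (l3 l'.1 (N l'.1 - l'.2.+1)%N) => //; lia.
  - by exfalso; apply: (k3 l.1 (N l.1 - l.2.+1)%N) => //; lia.
  case: l l1 l2 l3 h k3 => j n /= l1 l2 _ h _.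
  case: l' k1 k2 h => j' n' /= k1 k2 h; subst j'.
  have := Bdisj j t (N j - n.+1)%N (N j - n'.+1)%N ltac:(lia) ltac:(lia) l2 k2.
  by move=> h; congr pair; lia.
(* The default letter belongs to word 0, and N 0 <= N i makes it harmless from time N i on. *)
pose kappa t := if pselect (exists l, L l t) is left h then sval (cid h) else (0%N, 0%N).
have kL l t : L l t -> kappa t = l.
  move=> h; rewrite /kappa; case: pselect => [h'|[]]; last by exists l.
  exact: (L_uniq _ _ _ (svalP (cid h')) h).
have kN i t : ~ T i t -> forall m, (N i <= m)%N -> (N (kappa (iter m S t)).1 <= m)%N.
  move=> nT m im; rewrite {1}/kappa; case: pselect => [h|_]; last first.
    by apply: leq_trans im; exact: N_mono.
  case: (cid h) => -[j n] /= [/= jn [hB _]].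
  have [ji|ij] := leqP j i; first by apply: leq_trans im; exact: N_mono.
  rewrite leqNgt; apply/negP => mN; apply: nT; exists (j - i.+1)%N => //.
  rewrite subnKC//; apply/inD; exists (N j - n.+1 + m)%N; last by rewrite iterD.
  lia.
exists kappa; split.
- move=> l.
  have -> : kappa @^-1` [set l] = L l `|`
      (if l == (0%N, 0%N) then ~` \bigcup_k L k else set0).
    apply/seteqP; split => t /=.
      rewrite /kappa; case: pselect => [h <-|h <-]; first by left; exact: (svalP (cid h)).
      by right; rewrite eqxx => -[k _ hk]; apply: h; exists k.
    move=> [/kL //|]; case: eqP => // -> h; rewrite /kappa; case: pselect => // -[k hk].
    by exfalso; apply: h; exists k.
  apply: measurableU => //; case: eqP => // _; apply: measurableC.
  exact: measurable_bigcup_countType.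
(* Borel-Cantelli: the measures of the T i tend to 0. *)
- exists (~` \bigcap_i T i).
    have mI : measurable (\bigcap_i T i) by exact: bigcapT_measurable.
    split; first exact: measurableC.
    rewrite setCK prE//; congr EFin; apply/eqP; rewrite eq_le pr_ge0 andbT.
    apply/ler_addgt0Pr => e e0; rewrite add0r.
    have [n hn] := half_pow_lt e0.
    apply: (@le_trans _ _ (pr (T n))); first by apply: pr_le => // t; exact.
    apply: (le_trans (prT n)); apply: le_trans (ltW (hn n (leqnn n))).
    have := r1 n.+1; have := half_pow_gt0 R n; nra.
  move=> t; rewrite setC_bigcap => -[i _ hi]; exists (N i) => m; exact: kN.
(* A visit to B i at time N i - 1 means that word i starts at time 0; removing T i leaves positive
   measure because T i is smaller than B i. *)
move=> i; exists ((iter (N i).-1 S @^-1` B i) `\` T i).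
  have mE : measurable (iter (N i).-1 S @^-1` B i `\` T i).
    by apply: measurableD => //; exact: measurable_iter.
  split=> //; rewrite prE// lte_fin; apply: pr_gt0_setD => //; first exact: measurable_iter.
  rewrite pr_iter//; apply: (le_lt_trans (prT i)).
  have h1 : r i.+1 <= pr (B i) by rewrite rS ge_min lexx orbT.
  have h2 : (2^-1 : R) ^+ i <= 1 by rewrite exprn_ile1//; lra.
  have := r0 i.+1; nra.
move=> t [hB nT]; split; last exact: kN.
move=> n nN; apply: kL; split => //=; split.
  by rewrite -iterD (_ : _ + n = (N i).-1)%N//; lia.
move=> j k ij kNj hk; apply: nT; exists (j - i.+1)%N => //.
rewrite subnKC//; apply/inD; exists (k + n)%N; last by rewrite iterD.
have := N_mono (ltnW ij); lia.
Qed.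

End ergodic.

(** * Real coordinates on standard Lebesgue spaces *)

Section standard.
Context {R : realType}.

(** Meant for functions measurable only up to null sets: once [D] avoids the exceptional sets of the
    countably many rational cuts, the restriction extended by 0 is genuinely measurable. *)
Lemma measurable_fun_rat_cuts d (X : measurableType d) (D : set X) (f : X -> R) :
  measurable D ->
  (forall r : rat, exists2 B, measurable B & forall x, D x -> (f x < ratr r <-> B x)) ->
  measurable_fun setT (fun x => if x \in D then f x else 0).
Proof.
move=> mD hB.
have [B hB'] : exists B : rat -> set X, forall r, measurable (B r) /\
    forall x, D x -> (f x < ratr r <-> B r x).
  suff : forall r : rat, exists B, measurable B /\ forall x, D x -> (f x < ratr r <-> B x).
    by move=> /choice[B ?]; exists B.
  by move=> r; have [B ? ?] := hB r; exists B.
apply: (measurability _ (RGenInftyO.measurableE R)) => _ [_ [y ->] <-]; rewrite setTI.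
have -> : (fun x => if x \in D then f x else 0) @^-1` `]-oo, y[%classic =
    (D `&` \bigcup_(r in [set r : rat | ratr r < y]) B r) `|` (if 0 < y then ~` D else set0).
  apply/seteqP; split => x /=.
    rewrite in_itv/=; case: ifPn; rewrite ?notin_setE ?inE => Dx fy; last first.
      by right; rewrite fy.
    left; split => //.
    have [r] := rat_in_itvoo fy; rewrite in_itv/= => /andP[fr ry].
    by exists r => //; apply/(hB' r).2.
  rewrite in_itv/= => -[[Dx [r /= ry Br]]|].
    by rewrite mem_set//; apply: lt_trans ry; apply/(hB' r).2.
  by case: ifPn => // y0 nDx; rewrite memNset.
apply: measurableU.
  apply: measurableI => //; apply: measurable_bigcup_countType => r _.
  exact: (hB' r).1.
by case: ifPn => // _; exact: measurableC.
Qed.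

Lemma measure_eq_off_null d (X : measurableType d) (mu : {measure set X -> \bar R})
    (A B N : set X) : measurable A -> measurable B -> measurable N -> mu N = 0%E ->
  (forall x, ~ N x -> (A x <-> B x)) -> mu A = mu B.
Proof.
move=> mA mB mN N0 AB.
suff h C D : measurable C -> measurable D -> (forall x, ~ N x -> (C x -> D x)) -> (mu C <= mu D)%E.
  by apply/eqP; rewrite eq_le !h// => x /AB[].
move=> mC mD CD; apply: (@le_trans _ _ (mu (D `|` N))).
  apply: le_measure; rewrite ?inE//; first exact: measurableU.
  by move=> x Cx; have [Nx|nNx] := pselect (N x); [right|left; exact: CD].
by rewrite -[leRHS]adde0 -N0; exact: measureU2.
Qed.

Lemma measure0_sub d (X : measurableType d) (mu : {measure set X -> \bar R})
    (A N : set X) : measurable A -> measurable N -> mu N = 0%E -> A `<=` N -> mu A = 0%E.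
Proof.
move=> mA mN N0 AN; apply/eqP; rewrite eq_le measure_ge0 andbT -N0.
by apply: le_measure; rewrite ?inE.
Qed.

Lemma measure0_bigcup d (X : measurableType d) (mu : {measure set X -> \bar R})
    (F : nat -> set X) : (forall i, measurable (F i)) -> (forall i, mu (F i) = 0%E) ->
  mu (\bigcup_i F i) = 0%E.
Proof.
move=> mF F0; apply/eqP; rewrite eq_le measure_ge0 andbT.
have mU : measurable (\bigcup_i F i) by exact: bigcupT_measurable.
apply: (le_trans (generalized_Boole_inequality mu mF mU)).
by rewrite eseries0.
Qed.

Lemma measure0_setU d (X : measurableType d) (mu : {measure set X -> \bar R})
    (A B : set X) : measurable A -> measurable B -> mu A = 0%E -> mu B = 0%E ->
  mu (A `|` B) = 0%E.
Proof.
move=> mA mB A0 B0; apply/eqP; rewrite eq_le measure_ge0 andbT.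
by rewrite -[leRHS]adde0 -{1}A0 -B0; exact: measureU2.
Qed.

Lemma measure0_bigcup_countType d (X : measurableType d) (mu : {measure set X -> \bar R})
    (I : countType) (F : I -> set X) :
  (forall i, measurable (F i)) -> (forall i, mu (F i) = 0%E) -> mu (\bigcup_i F i) = 0%E.
Proof.
move=> mF F0.
pose G n := if (unpickle n : option I) is Some r then F r else set0.
have -> : \bigcup_i F i = \bigcup_n G n.
  apply/seteqP; split => x [i _ hi]; first by exists (pickle i) => //; rewrite /G pickleK.
  by move: hi; rewrite /G; case: unpickle => // r hr; exists r.
by apply: measure0_bigcup => n; rewrite /G; case: unpickle.
Qed.

(* The last clause, a measurability property of the images p @` A, dispenses with the Lusin-Souslin
   theorem. *)
Definition coordinate d (X : measurableType d) (mu : {measure set X -> \bar R})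
    (p : X -> R) (X1 : set X) :=
  [/\ measurable_fun setT p, measurable X1 /\ mu (~` X1) = 0%E,
      forall x y, X1 x -> X1 y -> p x = p y -> x = y &
      forall A, measurable A -> A `<=` X1 -> exists B N : set R,
        [/\ measurable B, measurable N, mu (p @^-1` N) = 0%E &
            forall t, ~ N t -> ((p @` A) t <-> B t)]].

Lemma lebesgue01_small (e : R) : 0 < e ->
  exists2 C : set R, measurable C & (0 < lebesgue01 C < e%:E)%E.
Proof.
move=> e0; pose m := Num.min (e / 2) 1.
have m0 : 0 < m by rewrite lt_min ltr01 divr_gt0.
exists `[0, m]%classic; first exact: measurable_itv.
rewrite /lebesgue01/= /mrestr.
have -> : `[0, m]%classic `&` `[0, 1]%classic = `[0, m]%classic :> set R.
  apply/seteqP; split => x /=; first by case.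
  rewrite !in_itv/= => /andP[-> xm]; split=> //=.
  by apply: (le_trans xm); rewrite ge_min lexx orbT.
rewrite lebesgue_measure_itv/= lte_fin m0 sube0 !lte_fin m0/=.
by rewrite gt_min; apply/orP; left; lra.
Qed.

(** The given isomorphism is measurable only for completed sigma-algebras; it becomes a measurable
    coordinate after removal of a null set for each rational cut and of the points sent outside
    [0,1]. *)
Lemma standard_lebesgue_coordinate d (X : measurableType d) (mu : probability X R) :
  standard_lebesgue mu -> exists (p : X -> R) (X1 : set X),
  [/\ coordinate mu p X1, forall x, 0 <= p x <= 1 &
      forall B, measurable B -> mu (p @^-1` B) = lebesgue01 B].
Proof.
move=> [X0 [Y0 [th [[mX0 X00] _ [thf thi _] H1 H2]]]].
have nul (B : set R) : measurable B -> exists BN : set X * set X,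
    [/\ measurable BN.1, measurable BN.2, mu BN.2 = 0%E, mu BN.1 = lebesgue01 B &
      forall x, ~ BN.2 x -> ((X0 `&` th @^-1` B) x <-> BN.1 x)].
  move=> mB; have [C [mC [N [mN N0 hN]] CB]] := H1 B mB.
  exists (C, N); split => //= x nN.
  split=> h; apply: contrapT => h2; apply: nN; apply: hN; first by left; split.
  by right; split.
have [cut hcut] : exists cut : rat -> set X * set X, forall r,
    [/\ measurable (cut r).1, measurable (cut r).2, mu (cut r).2 = 0%E &
      forall x, ~ (cut r).2 x -> ((X0 `&` th @^-1` `]-oo, ratr r[%classic) x <-> (cut r).1 x)].
  suff : forall r : rat, exists BN : set X * set X,
    [/\ measurable BN.1, measurable BN.2, mu BN.2 = 0%E &
      forall x, ~ BN.2 x -> ((X0 `&` th @^-1` `]-oo, ratr r[%classic) x <-> BN.1 x)].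
    by move=> /choice[f hf]; exists f.
  by move=> r; have [BN [? ? ? _ ?]] := nul `]-oo, ratr r[%classic (measurable_itv _); exists BN.
have [[U0 V0] /= [mU0 mV0 V00 U00 hU0]] :=
  nul (~` `[0, 1]%classic) (measurableC (measurable_itv _)).
have {}U00 : mu U0 = 0%E.
  by rewrite U00 /lebesgue01/= /mrestr setICl measure0.
pose W := (~` X0 `|` (U0 `|` V0)) `|` \bigcup_r (cut r).2.
have mc r : measurable (cut r).2 by case: (hcut r).
have mW : measurable W.
  apply: measurableU; last exact: measurable_bigcup_countType.
  by apply: measurableU; [exact: measurableC | exact: measurableU].
have W0 : mu W = 0%E.
  apply: measure0_setU.
  - by apply: measurableU; [exact: measurableC | exact: measurableU].
  - exact: measurable_bigcup_countType.
  - apply: measure0_setU => //; first exact: measurableC.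
      exact: measurableU.
    exact: measure0_setU.
  - by apply: measure0_bigcup_countType => // r; case: (hcut r).
pose X1 := ~` W.
have mX1 : measurable X1 by exact: measurableC.
have X10 x : X1 x -> X0 x by move=> h; apply: contrapT => h2; apply: h; left; left.
have X1c x r : X1 x -> ~ (cut r).2 x by move=> h h2; apply: h; right; exists r.
have X101 x : X1 x -> 0 <= th x <= 1.
  move=> h; apply: contrapT => h2; apply: (h); left; right.
  have [v|v] := pselect (V0 x); [by right | left].
  apply/hU0 => //; split; first by apply: X10.
  by rewrite /= in_itv.
pose p x := if x \in X1 then th x else 0.
have pth x : X1 x -> p x = th x by move=> h; rewrite /p mem_set.
have mp : measurable_fun setT p.
  apply: measurable_fun_rat_cuts => // r; exists (cut r).1; first by case: (hcut r).
  move=> x X1x; have [_ _ _ h] := hcut r; rewrite -h; last exact: X1c.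
  by rewrite /= in_itv/=; split=> [?|[]//]; split => //; exact: X10.
have pl B : measurable B -> mu (p @^-1` B) = lebesgue01 B.
  move=> mB; have [[C N] /= [mC mN N0 <- hC]] := nul B mB.
  apply: (@measure_eq_off_null _ _ _ _ _ (N `|` W)).
  - by rewrite -[X in measurable X]setTI; apply: mp.
  - by [].
  - exact: measurableU.
  - exact: measure0_setU.
  move=> x /not_orP[nN /= X1x]; rewrite -hC// /= pth//.
  by split=> [?|[]//]; split => //; exact: X10.
exists p, X1; split=> //; last first.
  by move=> x; rewrite /p; case: ifPn; rewrite ?inE ?lexx ?ler01// => /X101.
split=> //; first by rewrite setCK.
  move=> x y Xx Xy; rewrite !pth// => h; apply: thi => //; rewrite inE; exact: X10.
move=> A mA AX1; have [B [mB [N [mN N0 hN]] _]] := H2 A mA.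
exists B, N; split=> //; first exact: (etrans (pl N mN) N0).
move=> t nN.
have -> : p @` A = th @` (X0 `&` A).
  apply/seteqP; split=> _ [x Ax <-].
    by exists x; [split=> //; apply: X10; exact: AX1 | rewrite pth//; exact: AX1].
  by exists x; [case: Ax | rewrite pth//; apply: AX1; case: Ax].
split=> h; apply: contrapT => h2; apply: nN; apply: hN; first by left.
by right.
Qed.

(** [S] is q after the inverse of p. Its rational cuts are images under p, which a coordinate makes
    Borel off null sets; [D] avoids all of these. *)
Lemma coordinate_factor d (X : measurableType d) (mu : {measure set X -> \bar R})
    (p : X -> R) (X1 : set X) (q : X -> R) :
  coordinate mu p X1 -> measurable_fun setT q ->
  exists (S : R -> R) (D : set R),
  [/\ measurable_fun setT S, measurable D, mu (p @^-1` (~` D)) = 0%E,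
      D `<=` p @` X1 & forall x, X1 x -> D (p x) -> S (p x) = q x].
Proof.
move=> [mp [mX1 X10] pinj im] mq.
have mpre B : measurable B -> measurable (p @^-1` B).
  by move=> mB; rewrite -[X in measurable X]setTI; apply: mp.
have [Bs [Ns [mBs mNs Ns0 hs]]] := im X1 mX1 (@subset_refl _ _).
pose A (r : rat) := X1 `&` q @^-1` `]-oo, ratr r[%classic.
have [cut hcut] : exists cut : rat -> set R * set R, forall r,
    [/\ measurable (cut r).1, measurable (cut r).2, mu (p @^-1` (cut r).2) = 0%E &
      forall t, ~ (cut r).2 t -> ((p @` A r) t <-> (cut r).1 t)].
  suff : forall r : rat, exists BN : set R * set R,
    [/\ measurable BN.1, measurable BN.2, mu (p @^-1` BN.2) = 0%E &
      forall t, ~ BN.2 t -> ((p @` A r) t <-> BN.1 t)].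
    by move=> /choice[f hf]; exists f.
  move=> r; have [||B [N [? ? ? ?]]] := im (A r); last by exists (B, N).
    by apply: measurableI => //; rewrite -[X in measurable X]setTI; apply: mq.
  by move=> x [].
pose W := Ns `|` \bigcup_r (cut r).2.
have mc r : measurable (cut r).2 by case: (hcut r).
have mW : measurable W by apply: measurableU => //; exact: measurable_bigcup_countType.
have W0 : mu (p @^-1` W) = 0%E.
  rewrite preimage_setU preimage_bigcup; apply: measure0_setU => //; try exact: mpre.
    by apply: measurable_bigcup_countType => r _; exact: mpre.
  by apply: measure0_bigcup_countType => r; [exact: mpre | case: (hcut r)].
pose D := Bs `\` W.
have mD : measurable D by exact: measurableD.
have DX1 t : D t -> exists2 x, X1 x & p x = t.
  by move=> [Bt nW]; apply/hs => // Nt; apply: nW; left.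
pose S0 t := if pselect (exists x, X1 x /\ p x = t) is left h then q (sval (cid h)) else 0.
have S0p x : X1 x -> S0 (p x) = q x.
  move=> X1x; rewrite /S0; case: pselect => [h|[]]; last by exists x.
  by congr q; have [h1 h2] := svalP (cid h); exact: pinj.
exists (fun t => if t \in D then S0 t else 0), D; split => //.
- apply: measurable_fun_rat_cuts => // r; exists (cut r).1; first by case: (hcut r).
  move=> t Dt; have [_ _ _ h] := hcut r; rewrite -h; last first.
    by move=> h2; case: Dt => _; apply; right; exists r.
  have [x X1x <-] := DX1 t Dt; rewrite S0p//; split.
    by move=> qr; exists x => //; split => //=; rewrite in_itv.
  by move=> [y [X1y /=]]; rewrite in_itv/= => qy /pinj <-.
- apply: (@measure0_sub _ _ _ _ (p @^-1` W `|` ~` X1)).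
  + by apply: mpre; exact: measurableC.
  + by apply: measurableU; [exact: mpre | exact: measurableC].
  + apply: measure0_setU => //; first exact: mpre.
    exact: measurableC.
  move=> x /= nD; have [Xx|] := pselect (X1 x); last by right.
  left; apply: contrapT => nW; apply: nD; split => //.
  apply/hs; last by exists x.
  by move=> h; apply: nW; left.
- by move=> x Xx Dx; rewrite mem_set// S0p.
Qed.

End standard.

(** * Borel functions with values in a separable Banach space *)

Section borel_functions.
Context {R : realType} {K : numFieldType} (s : real_scalars R K).
Context {Z : completeNormedModType K}.
Hypothesis sepZ : separable Z.
Context d (X : measurableType d).
Local Notation rn := (rnorm s).
Local Notation bmeas f := (measurable_fun setT ((f : X -> Z) : X -> borel_space Z)).

Lemma bmeas_rdist (f : X -> Z) z : bmeas f -> measurable_fun setT (fun x => rn (f x - z)).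
Proof.
move=> mf; apply: (measurableT_comp (T2 := borel_space Z) (f := fun y : Z => rn (y - z))) => //.
apply: (lipschitz_measurable (s := s) (C := 1)) => x y.
have := ler_rdistD s y x z; have := ler_rdistD s x y z.
rewrite (rdistC s y x) mul1r ler_norml; lra.
Qed.

Lemma bmeasD (f g : X -> Z) : bmeas f -> bmeas g -> bmeas (fun x => f x + g x).
Proof.
move=> mf mg; have [zeta hz] := separable_dense_sequence s sepZ.
apply: (@measurability _ _ _ (borel_space Z) setT _ (@open Z : set (set (borel_space Z))) erefl).
move=> _ [U oU <-]; rewrite setTI.
pose b k n := [set y : Z | rn (y - zeta k) < 2^-1 ^+ n].
(* The pairs of basic balls whose sum stays in U; by continuity of addition they cover the preimage
   of U in the product. *)
pose Q (u : nat * nat * nat) := forall y y', b u.1.1 u.2 y -> b u.1.2 u.2 y' -> U (y + y').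
have mb (h : X -> Z) k n : bmeas h -> measurable (h @^-1` b k n).
  move=> mh; rewrite -[X in measurable X]setTI; apply: (mh measurableT).
  by apply: measurable_open_borel; exact: (rball_open s (zeta k)).

have -> : (fun x => f x + g x) @^-1` U =
    \bigcup_(u in Q) (f @^-1` b u.1.1 u.2 `&` g @^-1` b u.1.2 u.2).
  apply/seteqP; split=> x /=; last by move=> [u Qu [h1 h2]]; exact: Qu.
  move=> Uf; move/(open_rball s) : oU => /(_ _ Uf)[r r0 hr].
  have [n hn] := half_pow_lt (divr_gt0 r0 (ltr0n _ 4)).
  have [k hk] := hz (f x) _ (half_pow_gt0 R n).
  have [l hl] := hz (g x) _ (half_pow_gt0 R n).
  exists (k, l, n) => //= y y' /=; rewrite /b/= => hy hy'; apply: hr.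
  have := hn n (leqnn n).
  rewrite opprD addrACA; have := ler_rnormD s (y - f x) (y' - g x).
  have := ler_rdistD s (zeta k) y (f x); have := ler_rdistD s (zeta l) y' (g x).
  rewrite (rdistC s (zeta k)) (rdistC s (zeta l)); lra.
by apply: measurable_bigcup_countType => u _; apply: measurableI; exact: mb.
Qed.

Lemma bmeas_sum (f : nat -> X -> Z) n : (forall m, bmeas (f m)) ->
  bmeas (fun x => \sum_(0 <= m < n) f m x).
Proof.
move=> mf; elim: n => [|n IH].
  have -> : (fun x => \sum_(0 <= m < 0) f m x) = cst 0.
    by apply/funext => x; rewrite big_geq.
  exact: measurable_cst.
have -> : (fun x => \sum_(0 <= m < n.+1) f m x) = (fun x => \sum_(0 <= m < n) f m x + f n x).
  by apply/funext => x; rewrite big_nat_recr.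
exact: bmeasD.
Qed.

Lemma bmeas_lim (f : nat -> X -> Z) (h : X -> Z) : (forall n, bmeas (f n)) ->
  (forall x, tends s (f ^~ x) (h x)) -> bmeas h.
Proof.
move=> mf fh; apply: (@measurable_fun_borel_balls _ _ s Z _ X h sepZ) => z r r0.
have mh : measurable_fun setT (fun x => rn (h x - z)).
  apply: (measurable_fun_cvg (h := fun n x => rn (f n x - z))) => [n|x _].
    exact: bmeas_rdist.
  apply/cvgrPdist_lt => e e0; have [n hn] := fh x e e0.
  exists n => // m /= /hn; apply: le_lt_trans.
  have := ler_rdistD s (h x) (f m x) z; have := ler_rdistD s (f m x) (h x) z.
  rewrite (rdistC s (h x) (f m x)) ler_norml; lra.
have -> : [set x | rn (h x - z) < r] = (fun x => rn (h x - z)) @^-1` `]-oo, r[%classic.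
  by apply/seteqP; split=> x /=; rewrite in_itv.
by rewrite -[X in measurable X]setTI; apply: mh.
Qed.

(** The distances to a dense sequence determine a point, which leaves countably many equalities of
    real functions. *)
Lemma bmeas_eq (f g : X -> Z) : bmeas f -> bmeas g -> measurable [set x | f x = g x].
Proof.
move=> mf mg; have [zeta hz] := separable_dense_sequence s sepZ.
have -> : [set x | f x = g x] =
    \bigcap_k ((fun x => rn (f x - zeta k) - rn (g x - zeta k)) @^-1` [set 0]).
  apply/seteqP; split=> x /=; first by move=> h k _ /=; rewrite h subrr.
  move=> h; apply/eqP; rewrite -subr_eq0 -(rnorm_eq0 s) eq_le rnorm_ge0 andbT.
  apply/ler_addgt0Pr => e e0; have [k hk] := hz (f x) _ (divr_gt0 e0 (ltr0n _ 2)).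
  have /= := h k I; have := ler_rdistD s (zeta k) (f x) (g x).
  rewrite (rdistC s (zeta k)); lra.
apply: bigcapT_measurable => k; rewrite -[X in measurable X]setTI.
by apply: (measurable_funB (bmeas_rdist _ mf) (bmeas_rdist _ mg)).
Qed.

End borel_functions.

Section scalar_lipschitz.
Context {R : realType} {K : numFieldType} (s : real_scalars R K).
Context {Z : completeNormedModType K}.
Local Notation rn := (rnorm s).

Lemma lipschitz_real_bmeas (f : R -> Z) (C : R) :
  (forall x y, rn (f x - f y) <= `|x - y| * C) ->
  measurable_fun setT (f : R -> borel_space Z).
Proof.
move=> hf; have hf' x y : rn (f x - f y) <= `|x - y| * (`|C| + 1).
  by apply: (le_trans (hf x y)); rewrite ler_wpM2l//; have := ler_norm C; lra.
apply: (@measurability _ _ _ (borel_space Z) setT _ (@open Z : set (set (borel_space Z))) erefl).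
move=> _ [U oU <-]; rewrite setTI; apply: open_measurable.
rewrite openE => x Ufx; move/(open_rball s) : oU => /(_ _ Ufx)[r r0 hr].
have C1 : 0 < `|C| + 1 by rewrite ltr_wpDl.
apply/nbhs_ballP; exists (r / (`|C| + 1)) => /=; first by rewrite divr_gt0.
move=> y; rewrite /ball/= ltr_pdivlMr// => h; apply: hr.
by apply: le_lt_trans h; rewrite [X in X * _]distrC.
Qed.

Lemma bounded_operator_rnorm (A : {linear Z -> Z}) : bounded_operator A ->
  exists2 C, 0 <= C & forall z, rn (A z) <= C * rn z.
Proof. by move=> [M hM]; exact: (bounded_rnorm s hM). Qed.

Lemma bounded_operator_measurable (A : {linear Z -> Z}) : bounded_operator A ->
  measurable_fun setT (A : borel_space Z -> borel_space Z).
Proof.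
move=> /bounded_operator_rnorm[C C0 hC].
apply: (@measurability _ _ _ (borel_space Z) setT _ (@open Z : set (set (borel_space Z))) erefl).
move=> _ [U oU <-]; rewrite setTI; apply: measurable_open_borel.
apply/(open_rball s) => x Ufx; move/(open_rball s) : oU => /(_ _ Ufx)[r r0 hr].
have C1 : 0 < C + 1 by rewrite ltr_wpDl.
exists (r / (C + 1)); first by rewrite divr_gt0.
move=> y; rewrite ltr_pdivlMr// => h; apply: hr.
rewrite -linearB; apply: le_lt_trans h; apply: (le_trans (hC _)).
by rewrite mulrC ler_wpM2l ?rnorm_ge0//; lra.
Qed.

End scalar_lipschitz.

(** Ergodicity is assumed for strictly invariant sets, but the real model of T inherits invariance
    only up to null sets. The points visiting W infinitely often form a strictly invariant set that
    differs from W by a null set. *)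
Lemma ergodic_subinvariant (R : realType) d (X : measurableType d) (mu : probability X R)
    (T : X -> X) (W : set X) :
  ergodic mu T -> measurable W -> mu (W `\` T @^-1` W) = 0%E -> mu W = 0%E \/ mu W = 1%E.
Proof.
move=> [[mT pT] erg] mW W0.
have mpre A : measurable A -> measurable (T @^-1` A).
  by move=> mA; rewrite -[X in measurable X]setTI; exact: mT.
have mit n A : measurable A -> measurable (iter n T @^-1` A).
  elim: n A => [|n IH] A mA //; exact: (IH (T @^-1` A) (mpre A mA)).
have pit n A : measurable A -> mu (iter n T @^-1` A) = mu A.
  elim: n A => [|n IH] A mA //.
  by rewrite -(pT A mA) -(IH (T @^-1` A) (mpre A mA)).
pose N1 := \bigcup_n (iter n T @^-1` (W `\` T @^-1` W)).
have mWT : measurable (W `\` T @^-1` W) by apply: measurableD => //; exact: mpre.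
have mN1 : measurable N1 by apply: bigcupT_measurable => n; exact: mit.
have N10 : mu N1 = 0%E.
  apply: measure0_bigcup => n; first exact: mit.
  exact: (etrans (pit n _ mWT) W0).
have sub x m : ~ N1 x -> W x -> W (iter m T x).
  move=> nN Wx; elim: m => [|m IH] //; apply: contrapT => h; apply: nN.
  by exists m => //; split.
(* Entering W from outside is negligible too: the n-th preimage of W has the measure of W and
   contains almost all of W. *)
pose N2 := \bigcup_n (iter n T @^-1` W `\` W).
have mN2' n : measurable (iter n T @^-1` W `\` W) by apply: measurableD => //; exact: mit.
have mN2 : measurable N2 by exact: bigcupT_measurable.
have N20 : mu N2 = 0%E.
  apply: measure0_bigcup => n //.
  have mI : measurable (iter n T @^-1` W `&` W) by apply: measurableI => //; exact: mit.
  have e1 : mu (iter n T @^-1` W `&` W) = mu W.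
    apply: (measure_eq_off_null mI mW mN1 N10) => x nN.
    by split=> [[]//|Wx]; split => //; exact: sub.
  have : (mu (iter n T @^-1` W) = mu (iter n T @^-1` W `\` W) + mu (iter n T @^-1` W `&` W))%E.
    exact: (measureDI mu (mit n W mW) mW).
  rewrite e1 pit// !(prE mu)// -EFinD => -[] h.
  have : pr mu (iter n T @^-1` W `\` W) = 0 by move: h; lra.
  by move=> h0; rewrite -[LHS](fineK (fin_num_measure mu _ (mN2' n))); congr EFin.
pose W' := \bigcap_n \bigcup_(m in [set m | (n <= m)%N]) (iter m T @^-1` W).
have mW' : measurable W'.
  by apply: bigcapT_measurable => n; apply: bigcup_measurable => m _; exact: mit.
have invW' : T @^-1` W' = W'.
  apply/seteqP; split => x h n _.
    have [m /= nm hm] := h n I; exists m.+1 => /=; first exact: leqW.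
    by rewrite -iterS iterSr.
  have [m /= nm hm] := h n.+1 I; exists m.-1 => /=; first by lia.
  by rewrite -iterSr prednK//; lia.
have WW' : mu W' = mu W.
  apply: (@measure_eq_off_null _ _ _ _ _ _ (N1 `|` N2)) => //.
  - exact: measurableU.
  - exact: measure0_setU.
  move=> x /not_orP[n1 n2]; split => [h|Wx n _].
    have [m _ hm] := h 0%N I; apply: contrapT => nW; apply: n2; exists m => //.
  by exists n => //=; exact: sub.
rewrite -WW'; exact: erg.
Qed.

(** * Universality *)

Section universal.
Context {R : realType} {K : numFieldType} (s : real_scalars R K).
Context {Z : completeNormedModType K}.
Local Notation rn := (rnorm s).

Lemma quarter_half (N m : nat) : (N <= m)%N -> (2 : R) ^+ N * 4^-1 ^+ m <= 2^-1 ^+ m.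
Proof.
move=> Nm; have -> : (2^-1 : R) ^+ m = 2 ^+ m * 4^-1 ^+ m.
  by rewrite -exprMn; congr (_ ^+ _); lra.
by rewrite ler_wpM2r ?exprn_ge0// ler_eXn2l//; lra.
Qed.

(* The coordinate p conjugates T to a Borel map S of R; on R the factor map is
   H t = \sum_m c (kappa (S^m t)) (S^m t) m, and g o H = id makes its image Borel. *)
Lemma exists_universal_operator : separable Z -> complemented_subsymmetric Z ->
  exists A : {linear Z -> Z}, bounded_operator A /\ universal_for_ergodic R A.
Proof.
move=> sepZ csZ.
have [A [c [N [g [bA [Ngt Nmono cA] [cB cL] cD [mg gread]]]]]] := operator_with_letters s sepZ csZ.
exists A; split => // d X mu T sL eT.
have [p [X1 [cp p01 plaw]]] := standard_lebesgue_coordinate sL.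
have [mp [mX1 X10] pinj im] := cp.
have [[mT pT] _] := eT.
have mpre B : measurable B -> measurable (p @^-1` B).
  by move=> mB; rewrite -[X in measurable X]setTI; apply: mp.
have mTpre B : measurable B -> measurable (T @^-1` B).
  by move=> mB; rewrite -[X in measurable X]setTI; apply: mT.
have mTit n B : measurable B -> measurable (iter n T @^-1` B).
  elim: n B => [|n IH] B mB //; exact: (IH (T @^-1` B) (mTpre B mB)).
have pTit n B : measurable B -> mu (iter n T @^-1` B) = mu B.
  elim: n B => [|n IH] B mB //.
  by rewrite -(pT B mB) -(IH (T @^-1` B) (mTpre B mB)).
have [S [D0 [mS mD0 D00 D0X1 Sp]]] := coordinate_factor cp (measurableT_comp mp mT).
pose p' : {mfun X >-> R} := HB.pack p (isMeasurableFun.Build _ _ _ _ p mp).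
pose P : probability R R := distribution mu p'.
have PE B : P B = mu (p @^-1` B) by [].
pose W0 := p @^-1` (~` D0) `|` ~` X1.
have mW0 : measurable W0.
  by apply: measurableU; [apply: mpre; exact: measurableC | exact: measurableC].
have W00 : mu W0 = 0%E.
  by apply: measure0_setU => //; [apply: mpre; exact: measurableC | exact: measurableC].
have SpW x : ~ W0 x -> S (p x) = p (T x).
  by move=> /not_orP[/contrapT h1 /contrapT h2]; exact: Sp.
have mSpre B : measurable B -> measurable (S @^-1` B).
  by move=> mB; rewrite -[X in measurable X]setTI; apply: mS.
have pS B : measurable B -> P (S @^-1` B) = P B.
  move=> mB; rewrite !PE -[RHS]pT; last exact: mpre.
  apply: (@measure_eq_off_null _ _ _ _ _ _ W0) => //.
  - by apply: mpre; exact: mSpre.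
  - by apply: mTpre; exact: mpre.
  - by move=> x /SpW /= ->.
have ergS B : measurable B -> P (B `\` S @^-1` B) = 0%E -> P B = 0%E \/ P B = 1%E.
  move=> mB h; apply: (ergodic_subinvariant eT); first exact: mpre.
  rewrite -[RHS]h PE; apply: (@measure_eq_off_null _ _ _ _ _ _ W0) => //.
  - by apply: measurableD; [exact: mpre | apply: mTpre; exact: mpre].
  - by apply: mpre; apply: measurableD => //; exact: mSpre.
  - by move=> x /SpW h2 /=; rewrite /setD/= h2.
have smallP (e : R) : 0 < e -> exists2 C, measurable C & (0 < P C < e%:E)%E.
  by move=> /lebesgue01_small[C mC hC]; exists C => //; rewrite PE plaw.
have [kappa [mk [G [mG G0] hG] hE]] := ergodic_words mS pS ergS smallP Ngt Nmono.
have mSit n B : measurable B -> measurable (iter n S @^-1` B).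
  exact: (measurable_iter mS n).
have pSit n B : measurable B -> P (iter n S @^-1` B) = P B.
  move=> mB; rewrite -[LHS](fineK (fin_num_measure P _ (mSit n B mB))).
  rewrite -[RHS](fineK (fin_num_measure P _ mB)); congr EFin.
  exact: (pr_iter mS pS n mB).
have mI01 : measurable (`[0, 1]%classic : set R) by exact: measurable_itv.
(* The bounds on letters hold for parameters in [0,1], so the whole S-orbit has to stay there. *)
pose G2 := G `&` \bigcap_n (iter n S @^-1` `[0, 1]%classic).
have mG2 : measurable G2.
  by apply: measurableI => //; apply: bigcapT_measurable => n; exact: mSit.
have G20 : P (~` G2) = 0%E.
  rewrite setCI; apply: measure0_setU; rewrite ?G0//; first exact: measurableC.
    by apply: measurableC; apply: bigcapT_measurable => n; exact: mSit.
  rewrite setC_bigcap; apply: measure0_bigcup => n.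
    by apply: measurableC; exact: mSit.
  rewrite preimage_setC; apply: (etrans (pSit n _ (measurableC mI01))).
  rewrite PE (_ : p @^-1` _ = set0) ?measure0//.
  by apply/seteqP; split => x //=; rewrite in_itv/= p01.
have G2_01 t n : G2 t -> 0 <= iter n S t <= 1.
  by move=> [_ /(_ n I)]; rewrite /= in_itv.
pose term t m := c (kappa (iter m S t)) (iter m S t) m.
have termB t m : G2 t -> (N (kappa (iter m S t)).1 <= m)%N -> rn (term t m) <= 2^-1 ^+ m.
  move=> Gt h; apply: le_trans (quarter_half h); apply: cB; exact: G2_01.
have term_cvg t : G2 t -> exists z, tends s (fun n => \sum_(0 <= m < n) term t m) z.
  move=> Gt; have [m0 hm0] := hG t Gt.1.
  pose b m := if (m < m0)%N then rn (term t m) else 0.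
  have bB n : \sum_(0 <= m < n) b m <= \sum_(0 <= m < m0) b m.
    have b0 m : 0 <= b m by rewrite /b; case: ifP => // _; exact: rnorm_ge0.
    have [nm|mn] := leqP n m0.
      by rewrite [leRHS](big_cat_nat (leq0n n) nm)/= lerDl sumr_ge0.
    rewrite (big_cat_nat (leq0n m0) (ltnW mn))/= [X in _ + X]big_nat.
    by rewrite [X in _ + X]big1 ?addr0// => m /andP[h _]; rewrite /b ltnNge h.
  have [||z hz _] := @tends_sum_abs _ _ s _ (term t) (fun m => b m + 2^-1 ^+ m)
     (\sum_(0 <= m < m0) b m + 2); last by exists z.
    move=> m; rewrite /b; have [mm|mm] := ltnP m m0; first by rewrite lerDl exprn_ge0.
    by rewrite add0r; apply: termB => //; exact: hm0.
  move=> n; rewrite big_split/= lerD//.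
  by have := sum_half_pow_le R 0 n; rewrite expr0 mulr1.
have [H0 hH0] : exists H0 : R -> Z, forall t, G2 t ->
    tends s (fun n => \sum_(0 <= m < n) term t m) (H0 t).
  suff : forall t, exists z, G2 t -> tends s (fun n => \sum_(0 <= m < n) term t m) z.
    by move=> /choice[f hf]; exists f.
  move=> t; have [h|h] := pselect (G2 t); last by exists 0.
  by have [z hz] := term_cvg t h; exists z.
pose H t := if t \in G2 then H0 t else 0.
have hH t : G2 t -> tends s (fun n => \sum_(0 <= m < n) term t m) (H t).
  by move=> h; rewrite /H mem_set//; exact: hH0.
have mterm m : measurable_fun setT ((fun t => term t m) : R -> borel_space Z).
  apply: (@measurable_fun_countable_glue _ _ R (borel_space Z) (nat * nat)%type
     (fun l => iter m S @^-1` (kappa @^-1` [set l]))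
     (fun l t => c l (iter m S t) m) (fun t => term t m)).
  - by move=> l; apply: mSit; exact: mk.
  - by move=> t; exists (kappa (iter m S t)).
  - move=> l.
    have mc : measurable_fun setT ((fun u => c l u m) : R -> borel_space Z).
      exact: (lipschitz_real_bmeas (s := s) (fun u u' => cL l u u' m)).
    apply: (measurableT_comp mc).
    by move=> _ B mB; rewrite setTI; exact: mSit.
  - by move=> l t /= <-.
have mH : measurable_fun setT (H : R -> borel_space Z).
  apply: (@bmeas_lim _ _ s Z sepZ _ R
    (fun n t => if t \in G2 then \sum_(0 <= m < n) term t m else 0) H).
    move=> n; apply: (@measurable_fun_countable_glue _ _ R (borel_space Z) bool
      (fun b => if b then G2 else ~` G2)
      (fun b t => if b then \sum_(0 <= m < n) term t m else 0)
      (fun t => if t \in G2 then \sum_(0 <= m < n) term t m else 0)).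
    - by move=> [|] //; exact: measurableC.
    - by move=> t; have [h|h] := pselect (G2 t); [exists true | exists false].
    - move=> [|]; last exact: measurable_cst.
      exact: (@bmeas_sum _ _ s Z sepZ _ R (fun m t => term t m)).
    - by move=> [|] t h; [rewrite mem_set | rewrite memNset].
  move=> t; have [h|h] := pselect (G2 t).
    by rewrite mem_set//; exact: hH.
  by rewrite /H memNset//; exact: tends_cst.
have gH t : G2 t -> g (H t) = t.
  move=> Gt; exact: (gread (fun m => kappa (iter m S t)) (fun m => iter m S t) _ (hH t Gt)).
have [CA CA0 hCA] := bounded_operator_rnorm s bA.
(* A kills the term at time 0 and lowers every other chain by one step, which gives the series of S
   t reindexed. *)
have AH t : G2 t -> G2 (S t) -> A (H t) = H (S t).
  move=> Gt GSt.
  apply: (tends_uniq (s := s) (u := fun n => \sum_(0 <= m < n) term (S t) m)); last exact: hH.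
  move=> e e0; have CA1 : 0 < CA + 1 by lra.
  have [n0 hn0] := hH t Gt _ (divr_gt0 e0 CA1); exists n0 => n nn.
  have := hn0 n.+1 (leqW nn); rewrite ltr_pdivlMr//; apply: le_lt_trans.
  have -> : \sum_(0 <= m < n) term (S t) m = A (\sum_(0 <= m < n.+1) term t m).
    rewrite big_nat_recl// linearD linear_sum/= {1}/term (cA _ _).1 add0r.
    by apply: eq_bigr => m _; rewrite /term (cA _ _).2 iterSr.
  rewrite -linearB; apply: (le_trans (hCA _)); rewrite mulrC ler_wpM2l ?rnorm_ge0//; lra.
have mHp : measurable_fun setT ((H \o p) : X -> borel_space Z) by exact: (measurableT_comp mH mp).
pose Hp' : {mfun X >-> borel_space Z} :=
  HB.pack (H \o p : X -> borel_space Z) (isMeasurableFun.Build _ _ _ _ _ mHp).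
pose nu : probability (borel_space Z) R := distribution mu Hp'.
have nuE B : nu B = mu (p @^-1` (H @^-1` B)) by [].
have mHpre (B : set (borel_space Z)) : measurable B -> measurable (H @^-1` B : set (R)).
  by move=> mB; rewrite -[X in measurable X]setTI; apply: mH.
have mgpre B : measurable B -> measurable (g @^-1` B).
  by move=> mB; rewrite -[X in measurable X]setTI; apply: mg.
have mA := bounded_operator_measurable s bA.
exists nu; split.
- split => // B mB; rewrite !nuE -!PE.
  have mAB : measurable ((A : borel_space Z -> borel_space Z) @^-1` B).
    by rewrite -[X in measurable X]setTI; apply: mA.
  rewrite -[RHS]pS; last exact: mHpre.
  apply: (@measure_eq_off_null _ _ _ P _ _ (~` G2 `|` S @^-1` (~` G2))).
  + exact: mHpre.
  + by apply: mSpre; exact: mHpre.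
  + by apply: measurableU; [exact: measurableC | apply: mSpre; exact: measurableC].
  + apply: measure0_setU => //; first exact: measurableC.
      by apply: mSpre; exact: measurableC.
    exact: (etrans (pS _ (measurableC mG2)) G20).
  + by move=> t /not_orP[/contrapT h1 /contrapT h2] /=; rewrite AH.
(* On [E] word j is read first and every later term at time m is at most 2^-m, so H t differs from
   the value of the word by at most 2 / 2^(N j) < r. *)
- move=> U oU U0; have [r r0 hr] := cD U oU U0.
  have [j0 hj0] := half_pow_lt (divr_gt0 r0 (ltr0n _ 2)).
  have [j jj hj] := hr j0.
  have [E [mE E0] hEj] := hE j.
  have mEG : measurable (E `&` G2) by exact: measurableI.
  have mU : measurable (U : set (borel_space Z)) by exact: measurable_open_borel.
  have EG : P (E `&` G2) = P E.
    apply: (@measure_eq_off_null _ _ _ P _ _ (~` G2)) => //; first exact: measurableC.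
    by move=> t /contrapT h; split=> [[]|].
  rewrite nuE -PE; apply: (@lt_le_trans _ _ (P (E `&` G2))); first by rewrite EG.
  apply: le_measure; rewrite ?inE//; first exact: mHpre.
  move=> t [Et Gt] /=; have [h1 h2] := hEj t Et.
  apply: (hj (fun n => iter n S t)); first by move=> n; exact: G2_01.
  have -> : \sum_(0 <= n < N j) c (j, n) (iter n S t) n = \sum_(0 <= n < N j) term t n.
    by apply: eq_big_nat => n /andP[_ nN]; rewrite /term h1.
  rewrite rdistC; apply: (@le_lt_trans _ _ (2 * 2^-1 ^+ N j)); last first.
    by have := hj0 (N j) (leq_trans jj (ltnW (Ngt j))); lra.
  apply: (tends_le_eventually (N0 := N j) (tendsB (hH t Gt) (tends_cst s _))) => n nN.
  rewrite sum_natB//; apply: (le_trans (ler_rnorm_sum _ _ _ _)).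
  apply: le_trans (sum_half_pow_le R (N j) n).
  apply: ler_sum_nat => m /andP[Nm _]; apply: termB => //; exact: h2.
(* The points along whose whole orbit p is injective and conjugates T to S. *)
pose X2 := \bigcap_n (iter n T @^-1` (X1 `&` p @^-1` D0)).
have mX2' n : measurable (iter n T @^-1` (X1 `&` p @^-1` D0)).
  by apply: mTit; apply: measurableI => //; exact: mpre.
have mX2 : measurable X2 by exact: bigcapT_measurable.
have X20 : mu (~` X2) = 0%E.
  rewrite setC_bigcap; apply: measure0_bigcup => n; first exact: measurableC.
  rewrite preimage_setC; apply: (etrans (pTit n _ _)).
    by apply: measurableC; apply: measurableI => //; exact: mpre.
  by rewrite setCI setUC preimage_setC.
have X2T x : X2 x -> X2 (T x).
  by move=> h n _; have := h n.+1 I; rewrite /= -iterS iterSr.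
have X21 x : X2 x -> X1 x by move=> h; case: (h 0%N I).
have X2S x : X2 x -> S (p x) = p (T x) by move=> h; have [h1 h2] := h 0%N I; exact: Sp.
have X2it x n : X2 x -> iter n S (p x) = p (iter n T x).
  move=> h; elim: n => [|n IH] //; rewrite !iterS IH X2S//.
  by elim: n {IH} => [|n IH] //; exact: X2T.
have [Bs [Ns [mBs mNs Ns0 hs]]] := im X2 mX2 X21.
(* A Borel set of full P-measure inside the image of X2, which itself is known to be Borel only up
   to a null set. *)
pose D := (Bs `\` Ns) `&` G2.
have mD : measurable D by apply: measurableI => //; exact: measurableD.
have DX2 t : D t -> exists2 x, X2 x & p x = t by move=> [[Bt nN] _]; exact/hs.
have D_0 : mu (p @^-1` (~` D)) = 0%E.
  apply: (@measure0_sub _ _ _ _ _ (~` X2 `|` (p @^-1` Ns `|` p @^-1` (~` G2)))).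
  - by apply: mpre; exact: measurableC.
  - apply: measurableU; first exact: measurableC.
    by apply: measurableU; apply: mpre => //; exact: measurableC.
  - apply: measure0_setU => //; first exact: measurableC.
      by apply: measurableU; apply: mpre => //; exact: measurableC.
    by apply: measure0_setU => //; apply: mpre => //; exact: measurableC.
  move=> x /= nD; have [h1|] := pselect (X2 x); last by left.
  right; have [|h2] := pselect (Ns (p x)); first by left.
  right => h3; apply: nD; split => //; split => //.
  by apply/hs => //; exists x.
pose X3 := X2 `&` \bigcap_n (iter n T @^-1` (p @^-1` D)).
have mX3 : measurable X3.
  by apply: measurableI => //; apply: bigcapT_measurable => n; apply: mTit; exact: mpre.
have X30 : mu (~` X3) = 0%E.
  rewrite setCI; apply: measure0_setU => //; first exact: measurableC.
    by apply: measurableC; apply: bigcapT_measurable => n; apply: mTit; exact: mpre.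
  rewrite setC_bigcap; apply: measure0_bigcup => n.
    by apply: measurableC; apply: mTit; exact: mpre.
  rewrite preimage_setC; apply: (etrans (pTit n _ (measurableC (mpre _ mD)))).
  by rewrite preimage_setC.
have X3T x : X3 x -> X3 (T x).
  move=> [h1 h2]; split; first exact: X2T.
  by move=> n _; have := h2 n.+1 I; rewrite /= -iterS iterSr.
have X3G x : X3 x -> G2 (p x) by move=> [_ /(_ 0%N I)[]].
have X31 x : X3 x -> X1 x by move=> [/X21].
pose D' := \bigcap_n (iter n S @^-1` D).
have mD' : measurable D' by apply: bigcapT_measurable => n; exact: mSit.
have X3D x : X3 x -> D' (p x).
  by move=> [h1 h2] n _; have := h2 n I; rewrite /= X2it.
have D'X3 t : D' t -> exists2 x, X3 x & p x = t.
  move=> h; have [x X2x px] := DX2 t (h 0%N I); exists x => //; split => //.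
  by move=> n _; have := h n I; rewrite /= -px X2it.
(* This is the image of X3 under H after p, described through the left inverse [g] so as to be
   visibly Borel. *)
pose Y0 : set (borel_space Z) := [set z | D' (g z)] `&` [set z | H (g z) = z].
have mY0 : measurable Y0.
  apply: measurableI; first exact: (mgpre D').
  apply: (@bmeas_eq _ _ s Z sepZ _ (borel_space Z) (H \o g) idfun).
    exact: (measurableT_comp mH mg).
  exact: measurable_id.
have phiY x : X3 x -> Y0 (H (p x)).
  move=> h; have e := gH _ (X3G _ h).
  by split; rewrite /mkset e; first exact: (X3D x h).
have null_nu (B : set (borel_space Z)) : measurable B ->
    (forall x, X3 x -> ~ B (H (p x))) -> nu B = 0%E.
  move=> mB h; rewrite nuE; apply: (@measure0_sub _ _ _ _ _ (~` X3)) => //.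
  - by apply: mpre; exact: mHpre.
  - exact: measurableC.
  - by move=> x /= Bx X3x; exact: (h x).
have Y00 : nu (~` Y0) = 0%E.
  by apply: null_nu => [|x /phiY h]; [exact: measurableC | apply].
exists X3, Y0, (H \o p); split.
- split.
  + by split.
  + by split.
  + split => [x /phiY //|x y|z [D'z Hz]].
      rewrite !inE => X3x X3y /= h; apply: pinj; try exact: X31.
      by rewrite -[LHS](gH _ (X3G _ X3x)) h gH//; exact: X3G.
    by have [x X3x px] := D'X3 _ D'z; exists x => //=; rewrite px.
  + move=> B mB; exists ((H \o p) @^-1` B); split => //.
      exact: (mpre _ (mHpre B mB)).
    exists (~` X3); split => //; first exact: measurableC.
    by move=> x [[[]]//|[h1 h2]] X3x; apply: h2.
  + move=> C mC.
    have mXC : measurable (X3 `&` C) by exact: measurableI.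
    have [|B [Nb [mB mNb Nb0 hB]]] := im (X3 `&` C) mXC; first by move=> x [/X31].
    exists (g @^-1` B); split; first exact: mgpre.
      exists (~` Y0 `|` g @^-1` Nb); split.
      * by apply: measurableU; [exact: measurableC | exact: mgpre].
      * apply: measure0_setU => //; [exact: measurableC | exact: mgpre |].
        change (mu (p @^-1` (H @^-1` (g @^-1` Nb))) = 0%E).
        apply: (@measure0_sub _ _ _ _ _ (~` X3 `|` p @^-1` Nb)).
        -- by apply: mpre; apply: mHpre; exact: mgpre.
        -- by apply: measurableU; [exact: measurableC | exact: mpre].
        -- by apply: measure0_setU => //; [exact: measurableC | exact: mpre].
        move=> x /=; have [h|h] := pselect (X3 x); last by left.
        by rewrite gH; [right | exact: X3G].
      move=> z hz; apply: contrapT => /not_orP[/contrapT [D'z Hz] nN].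
      (* On Y0, images under the factor map are preimages under [g] of images under p, whose
         measurability is the last clause of [coordinate]. *)
      have im1 : ((H \o p) @` (X3 `&` C)) z <-> (p @` (X3 `&` C)) (g z).
        split=> [[x [X3x Cx] <-]|[x [X3x Cx] px]]; exists x => //=.
          by rewrite gH//; exact: X3G.
        by rewrite px.
      by case: hz => -[h1 h2]; apply: h2; [apply/hB => //; apply/im1 | apply/im1/hB].
    change (mu (p @^-1` (H @^-1` (g @^-1` B))) = mu C).
    apply: (@measure_eq_off_null _ _ _ _ _ _ (~` X3 `|` p @^-1` Nb)) => //.
    * by apply: mpre; apply: mHpre; exact: mgpre.
    * by apply: measurableU; [exact: measurableC | exact: mpre].
    * by apply: measure0_setU => //; [exact: measurableC | exact: mpre].
    move=> x /not_orP[/contrapT X3x nN] /=; rewrite gH; last exact: X3G.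
    rewrite -hB//; split; last by move=> Cx; exists x.
    by move=> [y [X3y Cy] /pinj <-//]; exact: X31.
- by move=> x /X3T.
- move=> z [D'z Hz]; have [x X3x px] := D'X3 _ D'z.
  rewrite -Hz -px AH; [|exact: X3G|rewrite X2S; [exact/X3G/X3T|by case: X3x]].
  by rewrite X2S; [exact/phiY/X3T | case: X3x].
- move=> x X3x /=; rewrite AH; [|exact: X3G|rewrite X2S; [exact/X3G/X3T|by case: X3x]].
  by rewrite X2S//; case: X3x.
Qed.

End universal.

(** * The real and the complex scalars *)

Section scalar_instances.
Context (R : realType).

Lemma real_cauchy_converges (u : nat -> R) :
  (forall eps : R, 0 < eps -> exists N, forall m n, (N <= m)%N -> (N <= n)%N ->
     `|u m - u n| < eps) ->
  exists l, forall eps : R, 0 < eps -> exists N, forall n, (N <= n)%N -> `|u n - l| < eps.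
Proof.
move=> uC; have /cauchy_cvgP cu : cauchy (u @ \oo).
  apply/cauchy_exP => e e0; have [N hN] := uC e e0.
  by exists (u N); exists N => // n /= Nn; apply: hN.
exists (limn u) => e e0; move/cvgrPdist_lt : cu => /(_ e e0)[N _ hN].
by exists N => n Nn; rewrite distrC; exact: hN.
Qed.

Definition real_real_scalars : real_scalars R R.
Proof.
apply: (@RealScalars R R idfun idfun) => //=.
exact: real_cauchy_converges.
Defined.

Lemma Re_zmod_morphism : zmod_morphism (@complex.Re R : R[i] -> R).
Proof. by move=> [a b] [a' b']. Qed.

Lemma Re_norm_complex (z : R[i]) :
  complex.Re `|z| = Num.sqrt (complex.Re z ^+ 2 + complex.Im z ^+ 2).
Proof. by rewrite normc_def. Qed.

Lemma Re_norm_le (z : R[i]) : complex.Re `|z| <= `|complex.Re z| + `|complex.Im z|.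
Proof.
rewrite Re_norm_complex -[leRHS]ger0_norm ?addr_ge0// -sqrtr_sqr ler_wsqrtr//.
rewrite sqrrD !real_normK ?num_real//.
by rewrite lerD2r lerDl mulrn_wge0// mulr_ge0.
Qed.

Lemma Re_le_Re_norm (z : R[i]) : `|complex.Re z| <= complex.Re `|z|.
Proof.
by rewrite Re_norm_complex -sqrtr_sqr ler_wsqrtr// lerDl sqr_ge0.
Qed.

Lemma Im_le_Re_norm (z : R[i]) : `|complex.Im z| <= complex.Re `|z|.
Proof.
by rewrite Re_norm_complex -sqrtr_sqr ler_wsqrtr// lerDr sqr_ge0.
Qed.

Definition complex_real_scalars : real_scalars R R[i].
Proof.
pose re : {additive R[i] -> R} :=
  HB.pack (@complex.Re R : R[i] -> R) (GRing.isZmodMorphism.Build _ _ _ Re_zmod_morphism).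
apply: (@RealScalars R R[i] (real_complex R) re) => //=.
- by move=> x x0; apply: RRe_real; exact: ger0_real.
- by move=> r r0; rewrite lecE /= eqxx.
- by move=> x; rewrite lecE /= => /andP[].
- exact: Re_le_Re_norm.
move=> u uC.
have [|a ha] := @real_cauchy_converges (fun n => complex.Re (u n)).
  move=> e e0; have [N hN] := uC e e0; exists N => m n Nm Nn.
  by rewrite -Re_zmod_morphism; apply: le_lt_trans (Re_le_Re_norm _) (hN m n Nm Nn).
have ImB (z w : R[i]) : complex.Im z - complex.Im w = complex.Im (z - w).
  by case: z w => [? ?] [? ?].
have [|b hb] := @real_cauchy_converges (fun n => complex.Im (u n)).
  move=> e e0; have [N hN] := uC e e0; exists N => m n Nm Nn.
  by rewrite ImB; apply: le_lt_trans (Im_le_Re_norm _) (hN m n Nm Nn).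
exists (Complex a b) => e e0; have e2 : 0 < e / 2 by rewrite divr_gt0.
have [N1 hN1] := ha _ e2; have [N2 hN2] := hb _ e2.
exists (maxn N1 N2) => n; rewrite geq_max => /andP[/hN1 h1 /hN2 h2].
apply: (le_lt_trans (Re_norm_le _)); rewrite [e]splitr ltrD//.
  by rewrite Re_zmod_morphism.
by rewrite -ImB.
Qed.

End scalar_instances.

Theorem theorem1p6 (R : realType) :
  (forall Z : completeNormedModType R,
     separable Z -> infinite_dimensional Z -> complemented_subsymmetric Z ->
     exists A : {linear Z -> Z},
       bounded_operator A /\ universal_for_ergodic R A) /\
  (forall Z : completeNormedModType R[i],
     separable Z -> infinite_dimensional Z -> complemented_subsymmetric Z ->
     exists A : {linear Z -> Z},
       bounded_operator A /\ universal_for_ergodic R A).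
Proof.
split=> Z sepZ _.
  exact: (exists_universal_operator (real_real_scalars R)).
exact: (exists_universal_operator (complex_real_scalars R)).
Qed.
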